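(* Let $\mathcal D$ be a dense linear subspace of a Hilbert space $\mathcal H$ such that $(\mathcal D,t)$ is an (F)-space, where $t$ is the graph topology induced by $\mathcal L^+(\mathcal D)$, and let $\mathcal A,\mathcal B\subset\mathcal L^+(\mathcal D)$ be standard operator algebras on $\mathcal D$. Suppose that $\Phi\colon\mathcal A\to\mathcal B$ is a $k$-Jordan map, i.e. $\Phi$ is bijective (no additivity is assumed) and there is a $k\in\mathbb Q$ such that $$\Phi(k(AB+BA))=k\left[\Phi(A)\Phi(B)+\Phi(B)\Phi(A)\right]\quad\text{for all }A,B\in\mathcal A.$$ Then $\Phi$ is a ring isomorphism or a ring antiisomorphism. So $\Phi$ has one of the following forms (four possibilities in all): (i) there exists a bijective, either linear or conjugate linear, operator $T\colon\mathcal D\to\mathcal D$ such that $\Phi(A)=TAT^{-1}$ for all $A\in\mathcal A$; or (ii) there exists a bijective, either linear or conjugate linear, operator $T\colon\mathcal D\to\mathcal D$ such that $\Phi(A)=TA^+T^{-1}$ for all $A\in\mathcal A$. If $T$ is linear, then it belongs to $\mathcal L^+(\mathcal D)$.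
   Context: For a dense linear subspace $\mathcal D$ of a complex Hilbert space $\mathcal H$, $\mathcal L^+(\mathcal D)$ denotes the set of all linear operators $A\colon\mathcal D\to\mathcal D$ whose Hilbert space adjoint $A^*$ is defined on $\mathcal D$ and satisfies $A^*\mathcal D\subset\mathcal D$. It is a $*$-algebra with the usual operations and the involution $A\mapsto A^+:=A^*|_{\mathcal D}$. The graph topology $t$ on $\mathcal D$ is the locally convex topology generated by the seminorms $\phi\mapsto\|A\phi\|$, $A\in\mathcal L^+(\mathcal D)$. $(\mathcal D,t)$ is an (F)-space if it is a Fréchet space (metrizable and complete). $\mathcal F(\mathcal D)\subset\mathcal L^+(\mathcal D)$ is the ideal of all finite rank operators on $\mathcal D$ in $\mathcal L^+(\mathcal D)$. A standard operator algebra on $\mathcal D$ is a subalgebra $\mathcal A\subset\mathcal L^+(\mathcal D)$ containing $\mathcal F(\mathcal D)$. A ring antiisomorphism is an additive bijection $\Phi$ with $\Phi(AB)=\Phi(B)\Phi(A)$.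
   Formalization: Assumes k ≠ 0 and dim D > 1, and infinite-dimensional D for forms (i)/(ii): k = 0 admits any bijection fixing 0; for dim 1, z ↦ z|z| (k = 1/2) is not additive; for finite dim ≥ 2, a wild automorphism of ℂ applied entrywise has neither form. *)

(* Defs.v *)
From HB Require Import structures.
From mathcomp Require Import all_boot all_order all_algebra.
From mathcomp Require Import sesquilinear complex.
From mathcomp Require Import all_classical all_reals topology normedtype.

Set Implicit Arguments.
Unset Strict Implicit.
Unset Printing Implicit Defensive.

Import Order.TTheory GRing.Theory Num.Theory.
Import numFieldNormedType.Exports.

Local Open Scope classical_set_scope.
Local Open Scope ring_scope.

(* V is spanned by n vectors, i.e. dim V <= n. *)
Definition spanned_by (K : pzRingType) (V : lmodType K) (n : nat) :=
  exists e : 'I_n -> V, forall x : V, exists c : 'I_n -> K,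
    x = \sum_(i < n) c i *: e i.

Definition infinite_dimensional (K : pzRingType) (V : lmodType K) :=
  forall n, ~ spanned_by V n.

(* Carrier of the linear subspace D, with the structure inherited from H. *)
Definition carrier (K : nzRingType) (H : lmodType K) (D : submodClosed H) :
  Type := {x : H | x \in D}.

HB.instance Definition _ (K : nzRingType) (H : lmodType K)
  (D : submodClosed H) := SubChoice.on (carrier D).
HB.instance Definition _ (K : nzRingType) (H : lmodType K)
  (D : submodClosed H) := [SubChoice_isSubLmodule of carrier D by <:].

Definition metrizable (R : realType) (X : topologicalType) :=
  exists d : X -> X -> R,
    [/\ forall x y, d x y = 0 <-> x = y,
        forall x y, d x y = d y x,
        forall x y z, d x z <= d x y + d y z &
        forall (x : X) (U : set X),
          nbhs x U <-> exists2 e : R, 0 < e & [set y | d x y < e] `<=` U].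

Definition complete_uniform (X : uniformType) :=
  forall F : set_system X, ProperFilter F -> cauchy F ->
    exists x : X, F --> x.

Section OperatorAlgebras.
Variables (R : realType) (H : completeNormedModType R[i]).
(* dot is linear in its first argument, conjugate linear in the second. *)
Variables (dot : {dot H for Num.conj}) (D : submodClosed H).

Local Notation C := R[i].
Local Notation op := (carrier D -> carrier D).

(* z is "A^* y": <A phi, y> = <phi, z> for all phi in D. Such a z is unique
   when D is dense. *)
Definition adjoint_rel (A : op) (y z : H) :=
  forall phi : carrier D, dot (val (A phi)) y = dot (val phi) z.

Definition adjoint_dom (A : op) : set H :=
  [set y | exists z, adjoint_rel A y z].

(* The value is 0 outside adjoint_dom A. *)
Definition adjoint (A : op) (y : H) : H := xget 0 [set z | adjoint_rel A y z].

Definition Lplus : set op :=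
  [set A | linear A /\ forall y : carrier D,
     adjoint_dom A (val y) /\ adjoint A (val y) \in D].

(* A^+, the restriction of A^* to D, as an operator D -> D; it is meaningful
   for A in Lplus (insubd replaces values outside D by 0). *)
Definition dagger (A : op) : op := fun y => insubd 0 (adjoint A (val y)).

(* The topology generated by the seminorms phi |-> `|A phi| for A in Lplus,
   together with its uniformity: since A is linear, the initial uniformity
   for A : D -> H has as entourages the sets
   {(phi, psi) | `|A (phi - psi)| < e}, and sup_topology takes the supremum
   over all A. *)
Definition graph_space : uniformType :=
  sup_topology (fun A : {A : op | Lplus A} =>
    Uniform.class (initial_topology (fun phi : carrier D => val (sval A phi)))).

Definition F_space := metrizable R graph_space /\ complete_uniform graph_space.

Definition finite_rank (A : op) :=
  exists n (e : 'I_n -> carrier D), forall phi, exists c : 'I_n -> C,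
    A phi = \sum_(i < n) c i *: e i.

Definition finite_rank_ops : set op := [set A | Lplus A /\ finite_rank A].

Definition standard_operator_algebra (AA : set op) :=
  [/\ AA `<=` Lplus, finite_rank_ops `<=` AA,
      forall A B, AA A -> AA B -> AA (A + B),
      forall (c : C) A, AA A -> AA (c *: A) &
      forall A B, AA A -> AA B -> AA (A \o B)].

(* A map from AA to BB is represented by a function on all of op, of which
   only the restriction to AA matters. The case k = 0, in which the identity
   only says Phi 0 = 0, is excluded. *)
Definition k_Jordan_map (AA BB : set op) (Phi : op -> op) :=
  set_bij AA BB Phi /\
  exists2 k : rat, k != 0 &
    forall A B, AA A -> AA B ->
      Phi (ratr k *: ((A \o B) + (B \o A))) =
      (ratr k : C) *: ((Phi A \o Phi B) + (Phi B \o Phi A)).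

Definition additive_bij (AA BB : set op) (Phi : op -> op) :=
  set_bij AA BB Phi /\
  forall A B, AA A -> AA B -> Phi (A + B) = Phi A + Phi B.

Definition ring_isomorphism (AA BB : set op) (Phi : op -> op) :=
  additive_bij AA BB Phi /\
  forall A B, AA A -> AA B -> Phi (A \o B) = Phi A \o Phi B.

Definition ring_antiisomorphism (AA BB : set op) (Phi : op -> op) :=
  additive_bij AA BB Phi /\
  forall A B, AA A -> AA B -> Phi (A \o B) = Phi B \o Phi A.

Definition conjugate_linear (T : op) :=
  linear_for ((Num.conj : C -> C) \; *:%R) T.

(* T is bijective with inverse T'. *)
Definition inverse_pair (T T' : op) := cancel T T' /\ cancel T' T.

Definition spatial_form (AA : set op) (Phi : op -> op) (T T' : op) :=
  forall A, AA A -> Phi A = T \o A \o T'.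

Definition spatial_dagger_form (AA : set op) (Phi : op -> op) (T T' : op) :=
  forall A, AA A -> Phi A = T \o dagger A \o T'.

End OperatorAlgebras.

(* Main.v *)
Require Import Defs.
From HB Require Import structures.
From mathcomp Require Import all_boot all_order all_algebra.
From mathcomp Require Import sesquilinear complex.
From mathcomp Require Import finmap all_classical all_reals topology normedtype.
From Stdlib Require Ncring Ncring_tac.

(** The algebraic half of the argument rests on one property of [AA] and [BB]:
    they are algebras of operators with a formal adjoint on the inner product
    space [carrier D], and they contain all rank one operators.  Such algebras
    are prime: if [a f b = 0] for all [f] of rank one, then [a = 0] or
    [b = 0].

    Additivity comes from a Peirce decomposition with respect to the orthogonal
    projection [p] onto a line.  By surjectivity there is [s] with
    [Phi s = Phi a + Phi b], and multiplying by [t] gives the same relation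
    between [s o t], [a o t] and [b o t], where [o] is the Jordan product.  So if
    [Phi] is already known to be additive at [(a o t, b o t)] for enough
    elements [t], then [s - (a + b)] anticommutes with all of them and
    vanishes ([additive_at_tests]).  Suitable sets of tests, taken among
    [p] and the corners, kill one of the two summands, and additivity then
    spreads from corner to corner.  An actual sum has to be created only once, in
    an off-diagonal corner, by the identity [(p + d) o (e + c) = k (c + d)], where
    [d e = d] ([additive_on_C12]).  Dimension at least two makes [1 - p] nonzero.

    Once [Phi] is additive it commutes with rational scalars, so the constant
    [k] drops out and [Phi] is an ordinary Jordan isomorphism onto a prime ring.
    Evaluating [Phi] on [a b x b a + b a x a b] in two ways shows that each pair
    [(a, b)] is multiplied either in order or in reverse order, and since a group
    is not the union of two proper subgroups one alternative holds throughout
    ([jordan_hom_or_antihom]).  Composing an antiisomorphism with the dagger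
    turns it into an isomorphism, so only isomorphisms remain to be implemented.

    An isomorphism sends a minimal idempotent to a minimal, hence rank one,
    idempotent with range spanned by some [u].  The map sending [x] to the value
    at [u] of [Phi (rank_one x y0)] is then a bijection [T] with [T A = Phi A T],
    and it is semilinear for some ring endomorphism [tau] of the complex numbers
    ([ring_isomorphism_semilinear]).  Adjointability of the operators in [BB]
    yields, for every [y], a vector [s] with [tau <z, y> = <T z, s>] for all [z].

    Completeness and metrizability enter only to show that [tau] is the identity
    or the conjugation.  If [tau] were unbounded near [0], one could choose along
    an orthogonal sequence [y_n] coefficients [c_n] so small that
    [sum c_n y_n] converges to some [psi] in the graph topology
    ([frechet_series]), and yet with [|tau c_n| > n |s_n|].  As
    [tau c_n = <T psi, s_n>] this contradicts the Cauchy-Schwarz inequality.  A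
    ring endomorphism bounded near [0] fixes the reals, which leaves two choices.

    Finally, when [T] is linear, comparing the adjoints of the rank one operators
    in [BB] with those of their preimages exhibits an adjoint of [T]. *)

Set Implicit Arguments.
Unset Strict Implicit.
Unset Printing Implicit Defensive.

Import Order.TTheory GRing.Theory Num.Theory.
Import numFieldNormedType.Exports.
Local Open Scope classical_set_scope.
Local Open Scope ring_scope.

(** Normalization in noncommutative rings, for the Peirce computations. *)
#[local] Instance ncring_ops (R : pzRingType) :
  @Ncring.Ring_ops R 0 1 +%R *%R (fun x y => x - y) -%R eq := {}.

#[local] Instance ncring_laws (R : pzRingType) :
  Ncring.Ring (Ro := ncring_ops R).
Proof.
constructor.
- exact _.
- by move=> a b -> c d ->.
- by move=> a b -> c d ->.
- by move=> a b -> c d ->.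
- by move=> a b ->.
- exact (@add0r R).
- exact (@addrC R).
- exact (@addrA R).
- exact (@mul1r R).
- exact (@mulr1 R).
- exact (@mulrA R).
- exact (@mulrDl R).
- exact (fun x y z => @mulrDr R z x y).
- by [].
- exact (@subrr R).
Qed.

Ltac ncring := Ncring_tac.non_commutative_ring.

(** * Peirce corners and the Jordan product *)

(** [A] is a prime subring of [R], possibly without unit: the complement
    [1 - p] lives in [R] only.  The element [k] is the scalar of the Jordan
    product; local units for elements of the off-diagonal corners replace
    [1 - p] where an element of [A] is required. *)
Record peirce_setting (R : pzRingType) (A : set R) (k p : R) : Prop := {
  ps_central : forall x, k * x = x * k;
  ps_unit : exists k', [/\ k * k' = 1, forall x, k' * x = x * k' &
    forall x, A x -> A (k' * x)];
  ps_2torsion_free : forall x : R, x + x = 0 -> x = 0;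
  ps_D : forall x y, A x -> A y -> A (x + y);
  ps_N : forall x, A x -> A (- x);
  ps_M : forall x y, A x -> A y -> A (x * y);
  ps_k : forall x, A x -> A (k * x);
  ps_p : A p;
  ps_idem : p * p = p;
  ps_neq0 : p <> 0;
  ps_neq1 : p <> 1;
  ps_prime : forall a b : R, (forall f, A f -> a * f * b = 0) -> a = 0 \/ b = 0;
  ps_local_unit_r : forall a, A a -> p * a = a -> a * p = 0 ->
    exists e, [/\ A e, p * e = 0, e * p = 0 & a * e = a];
  ps_local_unit_l : forall a, A a -> p * a = 0 -> a * p = a ->
    exists e, [/\ A e, p * e = 0, e * p = 0 & e * a = a]
}.

(** Passing to the converse ring exchanges the two off-diagonal corners, so
    that every statement on one of them also gives the statement on the other. *)
Lemma peirce_setting_converse (R : pzRingType) (A : set R) (k p : R) :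
  peirce_setting A k p -> @peirce_setting R^c A k p.
Proof.
case=> kC [k' [kk' k'C Ak']] R2 AD AN AM Ak Ap pp p0 p1 prm er el; split => //.
- by move=> x; rewrite -[LHS]/((x : R) * k) -kC.
- exists k'; split.
  + by rewrite -[LHS]/((k' : R) * k) -kC.
  + by move=> x; rewrite -[LHS]/((x : R) * k') -k'C.
  + by move=> x Ax; rewrite -[X in A X]/((x : R) * k') -k'C; exact: Ak'.
- by move=> x y Ax Ay; exact: AM.
- by move=> x Ax; rewrite -[X in A X]/((x : R) * k) -kC; apply: Ak.
- move=> a b H; case: (prm b a) => [f Af||]; [|by right|by left].
  by rewrite -mulrA; exact: H.
- by move=> a Aa pa ap; have [e [? ? ? ?]] := el a Aa ap pa; exists e.
- by move=> a Aa pa ap; have [e [? ? ? ?]] := er a Aa ap pa; exists e.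
Qed.

Definition jordan (R : pzRingType) (k a b : R) := k * (a * b + b * a).

Section PeirceCorners.
Variables (R : pzRingType) (A : set R) (p : R).
Definition peirce11 : set R := [set x | [/\ A x, p * x = x & x * p = x]].
Definition peirce12 : set R := [set x | [/\ A x, p * x = x & x * p = 0]].
Definition peirce21 : set R := [set x | [/\ A x, p * x = 0 & x * p = x]].
Definition peirce22 : set R := [set x | [/\ A x, p * x = 0 & x * p = 0]].
End PeirceCorners.

Section Additivity.
Variables (R : pzRingType) (A : set R) (k p : R).
Hypothesis AP : peirce_setting A k p.
Local Notation q := (1 - p).
Local Notation "a ** b" := (jordan k a b) (at level 40).

Local Notation C11 := (peirce11 A p).
Local Notation C12 := (peirce12 A p).
Local Notation C21 := (peirce21 A p).
Local Notation C22 := (peirce22 A p).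

Let AD := ps_D AP.
Let AN := ps_N AP.
Let AM := ps_M AP.
Let Ak := ps_k AP.
Let Ap := ps_p AP.
Let pp := ps_idem AP.
Let AB x y : A x -> A y -> A (x - y).
Proof. by move=> Ax Ay; apply: AD => //; exact: AN. Qed.
Let A0 : A 0. Proof. by rewrite -(subrr p); exact: AB. Qed.
Let AJ a b : A a -> A b -> A (a ** b).
Proof. by move=> Aa Ab; apply/Ak/AD; exact: AM. Qed.

Lemma central_unit_eq0 x : k * x = 0 -> x = 0.
Proof.
case: (ps_unit AP) => k' [kk' _ _] kx0.
by rewrite -[x]mul1r -kk' (ps_central AP) -mulrA kx0 mulr0.
Qed.

Lemma jordan0l a : 0 ** a = 0.
Proof. by rewrite /jordan mul0r mulr0 addr0 mulr0. Qed.

Lemma jordanDl a b c : (a + b) ** c = a ** c + b ** c.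
Proof. rewrite /jordan; ncring. Qed.

Lemma jordanDr a b c : c ** (a + b) = c ** a + c ** b.
Proof. rewrite /jordan; ncring. Qed.

Lemma mul_idem_compl : p * q = 0. Proof. by rewrite mulrBr mulr1 pp subrr. Qed.
Lemma mul_compl_idem : q * p = 0. Proof. by rewrite mulrBl mul1r pp subrr. Qed.
Lemma compl_idem : q * q = q. Proof. by rewrite {1}mulrBl mul1r mul_idem_compl subr0. Qed.
Lemma compl_neq0 : q <> 0.
Proof. by move/eqP; rewrite subr_eq0 eq_sym => /eqP; exact: (ps_neq1 AP). Qed.

Lemma peirce12_corner f : A f -> C12 (p * f * q).
Proof.
move=> Af; split; last by rewrite -(mulrA _ q p) mul_compl_idem mulr0.
  by rewrite mulrBr mulr1; apply: AB; repeat apply: AM.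
by rewrite !mulrA pp.
Qed.

Lemma peirce21_corner f : A f -> C21 (q * f * p).
Proof.
move=> Af; split; last by rewrite -(mulrA _ p p) pp.
  by rewrite mulrBl mul1r mulrBl; apply: AB; repeat apply: AM.
by rewrite !mulrA mul_idem_compl !mul0r.
Qed.

Lemma peirce22_corner f : A f -> C22 (q * f * q).
Proof.
move=> Af; split; last by rewrite -(mulrA _ q p) mul_compl_idem mulr0.
  rewrite mulrBr mulr1 mulrBl mul1r.
  by apply: AB; repeat (apply: AM || apply: AB).
by rewrite !mulrA mul_idem_compl !mul0r.
Qed.

Lemma peirce11_corner f : A f -> C11 (p * f * p).
Proof.
by move=> Af; split; [repeat apply: AM|rewrite !mulrA pp|rewrite -(mulrA _ p p) pp].
Qed.

Lemma idem_prime_l (b : R) : (forall f, A f -> p * f * b = 0) -> b = 0.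
Proof. by move=> /(ps_prime AP) [/(ps_neq0 AP)|]. Qed.

Lemma compl_prime_l (b : R) : (forall f, A f -> q * f * b = 0) -> b = 0.
Proof. by move=> /(ps_prime AP) [/compl_neq0|]. Qed.

Lemma compl_prime_r (b : R) : (forall f, A f -> b * f * q = 0) -> b = 0.
Proof. by move=> /(ps_prime AP) [|/compl_neq0]. Qed.

Lemma idem_prime_r (b : R) : (forall f, A f -> b * f * p = 0) -> b = 0.
Proof. by move=> /(ps_prime AP) [|/(ps_neq0 AP)]. Qed.

Definition anticommute (x t : R) := x * t + t * x = 0.

(** Which sets of tests [t] detect [x = 0] through [x * t + t * x]: the element
    [p] sees all corners but 22, and primeness takes over when [t] ranges over a
    full corner. *)
Lemma anticommute_idem x : anticommute x p -> p * x = 0 /\ x * p = 0.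
Proof.
move=> H.
have pxp : p * x * p = 0.
  have E : p * (x * p + p * x) * p = p * x * (p * p) + p * p * x * p by ncring.
  by apply: (ps_2torsion_free AP); move: E; rewrite H pp mulr0 mul0r.
split.
  have : p * (x * p + p * x) = 0 by rewrite H mulr0.
  by rewrite mulrDr !mulrA pp pxp add0r.
have : (x * p + p * x) * p = 0 by rewrite H mul0r.
by rewrite mulrDl -mulrA pp pxp addr0.
Qed.

Lemma anticommute_C22 x : (forall t, C22 t -> anticommute x t) ->
  q * x = 0 /\ x * q = 0.
Proof.
move=> H.
have qx : q * x = 0.
  apply: compl_prime_l => g Ag; apply: compl_prime_l => f Af.
  have Cf := peirce22_corner Af; have Cg := peirce22_corner Ag.
  have Cfg : C22 (q * f * q * (q * g * q)).
    have [? pf _] := Cf; have [? _ gp] := Cg.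
    by split; [exact: AM|rewrite (mulrA p) pf mul0r|rewrite -(mulrA _ _ p) gp mulr0].
  apply: (ps_2torsion_free AP).
  have -> : q * f * (q * g * (q * x)) = q * f * q * (q * g * q) * x.
    by rewrite -{2}compl_idem !mulrA.
  (* x commutes with t s by anticommuting twice, and anticommutes with t s
     because this product is again in the corner. *)
  set t := q * f * q in Cf Cfg *; set s := q * g * q in Cg Cfg *.
  have -> : t * s * x + t * s * x =
    (x * (t * s) + (t * s) * x) - (x * t + t * x) * s + t * (x * s + s * x).
    ncring.
  by rewrite !H//; ncring.
split=> //; apply: compl_prime_r => f Af.
have -> : x * q * f * q =
    (x * (q * f * q) + q * f * q * x) - q * f * (q * x) by ncring.
by rewrite qx mulr0 subr0 (H _ (peirce22_corner Af)).
Qed.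

Lemma peirce_decomposition x : x = p * x * p + p * x * q + (q * x * p + q * x * q).
Proof. ncring. Qed.

Lemma anticommute_C12 x : p * x = 0 -> x * p = 0 ->
  (forall t, C12 t -> anticommute x t) -> x = 0.
Proof.
move=> px xp H; apply: idem_prime_l => f Af.
have := H _ (peirce12_corner Af); rewrite /anticommute => E.
have -> : p * f * x = x * (p * f * q) + p * f * q * x
  - (x * p) * f * q + p * f * (p * x) by ncring.
by rewrite E px xp; ncring.
Qed.

Lemma anticommute_idem_C12 x :
  (forall t, ([set p] `|` C12) t -> anticommute x t) -> x = 0.
Proof.
move=> H; have [px xp] := anticommute_idem (H p (or_introl erefl)).
by apply: anticommute_C12 => // t Ct; apply: H; right.
Qed.

Lemma anticommute_C12_C22 x :
  (forall t, (C12 `|` C22) t -> anticommute x t) -> x = 0.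
Proof.
move=> H; have [qx xq] : q * x = 0 /\ x * q = 0.
  by apply: anticommute_C22 => // t Ct; apply: H; right.
suff xp : x * p = 0 by rewrite -[x]mulr1 -(subrK p 1) mulrDr xq xp addr0.
apply: compl_prime_r => f Af.
have -> : x * p * f * q = (x * (p * f * q) + p * f * q * x)
  - p * f * (q * x) by ncring.
by rewrite qx mulr0 subr0; apply: H; left; exact: peirce12_corner.
Qed.

Lemma idem_C12_sub : [set p] `|` C12 `<=` A.
Proof. by move=> t [->|[]]. Qed.

Lemma C12_C22_sub : C12 `|` C22 `<=` A.
Proof. by move=> t [[]|[]]. Qed.

Lemma mul_eq0_first_row a b : a * p = 0 -> p * b = b -> a * b = 0.
Proof. by move=> ap <-; rewrite mulrA ap mul0r. Qed.

Lemma mul_eq0_second_row a b : a * p = a -> p * b = 0 -> a * b = 0.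
Proof. by move=> <- pb; rewrite -mulrA pb mulr0. Qed.

Lemma jordan_orthogonal a b : a * b = 0 -> b * a = 0 -> a ** b = 0.
Proof. by rewrite /jordan => -> ->; rewrite addr0 mulr0. Qed.

Lemma jordan_C12_C12 a b : C12 a -> C12 b -> a ** b = 0.
Proof.
move=> [_ pa ap] [_ pb bp].
by apply: jordan_orthogonal; [exact: mul_eq0_first_row ap pb|exact: mul_eq0_first_row bp pa].
Qed.

Lemma jordan_C11_C22 a b : C11 a -> C22 b -> a ** b = 0.
Proof.
move=> [_ pa ap] [_ pb bp].
by apply: jordan_orthogonal; [exact: mul_eq0_second_row ap pb|exact: mul_eq0_first_row bp pa].
Qed.

Lemma peirce11_idem : C11 p. Proof. by split. Qed.

Lemma jordan_C22_C11 a b : C22 a -> C11 b -> a ** b = 0.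
Proof. by move=> Ca Cb; rewrite /jordan addrC; exact: jordan_C11_C22. Qed.

(** * Additivity of Jordan multiplicative bijections *)

(** The target of [phi] is an additive group with a biadditive operation, such as
    the Jordan product of another ring. *)
Variables (M : zmodType) (B : set M) (jordanM : M -> M -> M) (phi : R -> M).
Hypothesis phi_bij : set_bij A B phi.
Hypothesis BD : forall x y, B x -> B y -> B (x + y).
Hypothesis jordanMDl : forall x y z, B x -> B y -> B z ->
  jordanM (x + y) z = jordanM x z + jordanM y z.
Hypothesis jordanMDr : forall x y z, B x -> B y -> B z ->
  jordanM z (x + y) = jordanM z x + jordanM z y.
Hypothesis phiJ : forall a b, A a -> A b ->
  phi (jordan k a b) = jordanM (phi a) (phi b).

Let phiB a : A a -> B (phi a).
Proof. by case: phi_bij => H _ _; exact: H. Qed.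

Definition additive_at a b := phi (a + b) = phi a + phi b.

Definition additive_on (V : set R) :=
  forall a b, V a -> V b -> additive_at a b.

Lemma jordan_map0 : phi 0 = 0.
Proof.
have [_ _ surj] := phi_bij.
(* With phi a = phi 0 + phi 0, expanding phi (0 ** a) doubles phi 0. *)
have [a Aa ha] := surj _ (BD (phiB A0) (phiB A0)).
have h x : A x -> phi 0 = jordanM (phi 0) (phi x).
  by move=> Ax; rewrite -phiJ// jordan0l.
have /eqP : phi 0 = phi 0 + phi 0.
  by rewrite {1}(h a Aa) ha jordanMDr; try exact: phiB; rewrite -h.
by rewrite -subr_eq0 opprD addNKr oppr_eq0 => /eqP.
Qed.

Lemma additive_at0r a : additive_at a 0.
Proof. by rewrite /additive_at jordan_map0 !addr0. Qed.

Lemma additive_at0l a : additive_at 0 a.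
Proof. by rewrite /additive_at jordan_map0 !add0r. Qed.

Lemma additive_atC a b : additive_at a b -> additive_at b a.
Proof. by rewrite /additive_at addrC => ->; rewrite addrC. Qed.

Lemma jordan_map_split s a b t : A s -> A a -> A b -> A t ->
  phi s = phi a + phi b -> phi (s ** t) = phi (a ** t) + phi (b ** t).
Proof.
by move=> As Aa Ab At sab; rewrite !phiJ// sab jordanMDl//; exact: phiB.
Qed.

Lemma additive_at_defect s a b t : A s -> A a -> A b -> A t ->
  phi s = phi a + phi b -> additive_at (a ** t) (b ** t) ->
  (s - (a + b)) * t + t * (s - (a + b)) = 0.
Proof.
move=> As Aa Ab At sab; rewrite /additive_at -(jordan_map_split As) // => st.
have {}st : (a + b) ** t = s ** t.
  rewrite jordanDl; case: phi_bij => _ inj _.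
  apply: inj st; apply: mem_set; last exact: AJ.
  by apply: AD; exact: AJ.
apply: central_unit_eq0; rewrite -[RHS](subrr (s ** t)) -{2}st /jordan; ncring.
Qed.

Lemma additive_at_from_defect a b : A a -> A b ->
  (forall s, A s -> phi s = phi a + phi b -> s - (a + b) = 0) ->
  additive_at a b.
Proof.
move=> Aa Ab H; have [_ _ +] := phi_bij.
move=> /(_ _ (BD (phiB Aa) (phiB Ab))) [s As sab].
by rewrite /additive_at -sab; congr phi; apply/esym/eqP; rewrite -subr_eq0 H.
Qed.

(** The engine of the additivity proof: additivity at [(a, b)] may be tested after
    multiplication by the elements of any set whose anticommutant is [0]. *)
Lemma additive_at_tests (T : set R) a b : A a -> A b -> T `<=` A ->
  (forall x, A x -> (forall t, T t -> x * t + t * x = 0) -> x = 0) ->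
  (forall t, T t -> additive_at (a ** t) (b ** t)) -> additive_at a b.
Proof.
move=> Aa Ab TA annT H; apply: additive_at_from_defect => // s As sab; apply: annT.
  by apply: AB => //; exact: AD.
by move=> t Tt; apply: additive_at_defect; try exact: H; try exact: TA.
Qed.

Lemma additive_on_sum (V W : set R) :
  (forall a b, V a -> V b -> V (a + b)) ->
  (forall a b, W a -> W b -> W (a + b)) ->
  additive_on V -> additive_on W ->
  (forall a b, V a -> W b -> additive_at a b) ->
  additive_on [set x | exists a b, [/\ V a, W b & x = a + b]].
Proof.
move=> VD WD aV aW aVW x y [a [b [Va Wb ->]]] [c [d [Vc Wd ->]]].
have -> : additive_at (a + b) (c + d) =
    (phi ((a + c) + (b + d)) = phi (a + b) + phi (c + d)).
  by rewrite /additive_at addrACA.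
rewrite (aVW _ _ (VD _ _ Va Vc) (WD _ _ Wb Wd)) (aV _ _ Va Vc).
by rewrite (aW _ _ Wb Wd) (aVW _ _ Va Wb) (aVW _ _ Vc Wd) addrACA.
Qed.

(** In each of these mixed cases every test kills one of the two summands. *)
Lemma additive_at_C11_C12 a b : C11 a -> C12 b -> additive_at a b.
Proof.
move=> Ca Cb; have [Aa _ _] := Ca; have [Ab _ _] := Cb.
apply: (additive_at_tests Aa Ab C12_C22_sub) => [x _ /anticommute_C12_C22//|].
move=> t [Ct|Ct].
  by rewrite (jordan_C12_C12 Cb Ct); exact: additive_at0r.
by rewrite (jordan_C11_C22 Ca Ct); exact: additive_at0l.
Qed.

Lemma additive_at_C22_C12 a b : C22 a -> C12 b -> additive_at a b.
Proof.
move=> Ca Cb; have [Aa _ _] := Ca; have [Ab _ _] := Cb.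
apply: (additive_at_tests Aa Ab idem_C12_sub) => [x _ /anticommute_idem_C12//|].
move=> t [->|Ct].
  by rewrite (jordan_C22_C11 Ca peirce11_idem); exact: additive_at0l.
by rewrite (jordan_C12_C12 Cb Ct); exact: additive_at0r.
Qed.

(** A sum inside the corner is produced as a single Jordan product of two elements
    at which additivity is already known: with [e] a local unit, [d * e = d],
    [(p + d) ** (e + c) = k * c + k * d]. *)
Lemma additive_on_C12 : additive_on C12.
Proof.
move=> a b Ca Cb; apply: additive_atC.
have [k' [kk' k'C Ak']] := ps_unit AP.
have k'C12 x : C12 x -> C12 (k' * x).
  move=> [Ax px xp]; split; first exact: Ak'.
    by rewrite mulrA -k'C -mulrA px.
  by rewrite -mulrA xp mulr0.
have kk'x x : k * (k' * x) = x by rewrite mulrA kk' mul1r.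
have Cd := k'C12 _ Ca; have Cc := k'C12 _ Cb.
rewrite -(kk'x a) -(kk'x b).
move: (k' * a) (k' * b) Cd Cc => {a b Ca Cb} d c Cd Cc.
have [Ad pd dp] := Cd; have [Ac pc cp] := Cc.
have [e [Ae pe ep de]] := ps_local_unit_r AP Ad pd dp.
have Ce : C22 e by split.
have Epc : p ** c = k * c by rewrite /jordan pc cp addr0.
have Ede : d ** e = k * d by rewrite /jordan de (mul_eq0_first_row ep pd) addr0.
have Epe : p ** e = 0 by exact: jordan_C11_C22 peirce11_idem Ce.
have Edc : d ** c = 0 by exact: jordan_C12_C12.
have E : (p + d) ** (e + c) = k * c + k * d.
  have -> : (p + d) ** (e + c) = p ** e + d ** c + p ** c + d ** e.
    by rewrite /jordan; ncring.
  by rewrite Epe Edc Epc Ede !add0r.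
rewrite /additive_at -E phiJ; try exact: AD.
rewrite (additive_at_C11_C12 peirce11_idem Cd) (additive_at_C22_C12 Ce Cc).
rewrite jordanMDl ?jordanMDr; try exact: phiB; last by apply: BD; exact: phiB.
by rewrite -!phiJ// Epe Edc Epc Ede jordan_map0 add0r addr0.
Qed.

Lemma idem_mul_central x : p * (k * x) = k * (p * x).
Proof. by rewrite mulrA -(ps_central AP) -mulrA. Qed.

Lemma peirce12_mul_central x : C12 x -> C12 (k * x).
Proof.
by move=> [Ax px xp]; split; [exact: Ak|rewrite idem_mul_central px|rewrite -mulrA xp mulr0].
Qed.

Lemma jordan_C11_C12 a t : C11 a -> C12 t -> C12 (a ** t).
Proof.
move=> [Aa pa ap] [At pt tp]; rewrite /jordan (mul_eq0_first_row tp pa) addr0.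
by apply: peirce12_mul_central; split; [exact: AM|rewrite mulrA pa|rewrite -mulrA tp mulr0].
Qed.

Lemma additive_on_C11 : additive_on C11.
Proof.
move=> a b Ca Cb; have [Aa _ _] := Ca; have [Ab _ _] := Cb.
apply: (additive_at_tests Aa Ab C12_C22_sub) => [x _ /anticommute_C12_C22//|].
move=> t [Ct|Ct]; first by apply: additive_on_C12; exact: jordan_C11_C12.
by rewrite (jordan_C11_C22 Ca Ct); exact: additive_at0l.
Qed.

Lemma additive_on_first_row : additive_on [set x | A x /\ p * x = x].
Proof.
have C11D a b : C11 a -> C11 b -> C11 (a + b).
  move=> [Aa pa ap] [Ab pb bp].
  by split; [exact: AD|rewrite mulrDr pa pb|rewrite mulrDl ap bp].
have C12D a b : C12 a -> C12 b -> C12 (a + b).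
  move=> [Aa pa ap] [Ab pb bp].
  by split; [exact: AD|rewrite mulrDr pa pb|rewrite mulrDl ap bp addr0].
have H := additive_on_sum C11D C12D additive_on_C11 additive_on_C12
  additive_at_C11_C12.
suff sp x : A x /\ p * x = x ->
    exists a b, [/\ C11 a, C12 b & x = a + b].
  by move=> a b /sp pa /sp pb; exact: H.
move=> [Ax px]; exists (p * x * p), (p * x * q); split.
- exact: peirce11_corner.
- exact: peirce12_corner.
- by rewrite -mulrDr addrC subrK mulr1.
Qed.

(** On block upper triangular elements, the product with [p] lies in the first row
    and the product with the corner 12 lies in that corner. *)
Lemma additive_on_upper : additive_on [set x | A x /\ q * x * p = 0].
Proof.
move=> a b [Aa qap] [Ab qbp].
apply: (additive_at_tests Aa Ab idem_C12_sub) => [x _ /anticommute_idem_C12//|].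
have E x : q * x = 0 -> p * x = x.
  by move/eqP; rewrite mulrBl mul1r subr_eq0 eq_sym => /eqP.
have qk x : q * (k * x) = k * (q * x).
  by rewrite mulrA -(ps_central AP) -mulrA.
move=> t [->|Ct].
  apply: additive_on_first_row; split; try exact: AJ; apply: E.
    by rewrite qk mulrDr !mulrA qap mul_compl_idem mul0r addr0 mulr0.
  by rewrite qk mulrDr !mulrA qbp mul_compl_idem mul0r addr0 mulr0.
have [At pt tp] := Ct.
have qt : q * t = 0 by rewrite mulrBl mul1r pt subrr.
have J x : A x -> q * x * p = 0 -> C12 (x ** t).
  move=> Ax qxp; have qxt : q * x * t = 0 by rewrite -pt mulrA qxp mul0r.
  apply: peirce12_mul_central; split; first by apply: AD; exact: AM.
    by apply: E; rewrite mulrDr !mulrA qxt qt mul0r addr0.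
  rewrite mulrDl -(mulrA x t) tp mulr0 add0r -(mulrA t x).
  have -> : x * p = p * x * p + q * x * p by ncring.
  by rewrite qxp addr0 mulrA mulrA tp !mul0r.
by apply: additive_on_C12; exact: J.
Qed.

End Additivity.

Section AdditivityOnAlgebra.
Variables (R : pzRingType) (A : set R) (k p : R).
Hypothesis AP : peirce_setting A k p.
Variables (M : zmodType) (B : set M) (jordanM : M -> M -> M) (phi : R -> M).
Hypothesis phi_bij : set_bij A B phi.
Hypothesis BD : forall x y, B x -> B y -> B (x + y).
Hypothesis jordanMDl : forall x y z, B x -> B y -> B z ->
  jordanM (x + y) z = jordanM x z + jordanM y z.
Hypothesis jordanMDr : forall x y z, B x -> B y -> B z ->
  jordanM z (x + y) = jordanM z x + jordanM z y.
Hypothesis phiJ : forall a b, A a -> A b ->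
  phi (jordan k a b) = jordanM (phi a) (phi b).

Local Notation q := (1 - p).
Local Notation "a ** b" := (jordan k a b) (at level 40).
Local Notation C12 := (peirce12 A p).
Local Notation C21 := (peirce21 A p).
Local Notation C22 := (peirce22 A p).
Local Notation additive_at := (additive_at phi).
Local Notation additive_on := (additive_on phi).

Let AD := ps_D AP.
Let AN := ps_N AP.
Let AM := ps_M AP.
Let Ak := ps_k AP.

Lemma peirce21_converse (x : R) : C21 x -> @peirce12 R^c A p x.
Proof. by case=> Ax px xp; split. Qed.

Lemma jordan_converse (x y : R) : @jordan R^c k x y = x ** y.
Proof.
by rewrite /jordan -[LHS]/(((y * x) + (x * y)) * k) -(ps_central AP) addrC.
Qed.

Lemma additive_on_C21 : additive_on C21.
Proof.
move=> a b /peirce21_converse Ca /peirce21_converse Cb.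
apply: (additive_on_C12 (peirce_setting_converse AP) phi_bij BD jordanMDl
  jordanMDr _ Ca Cb) => x y Ax Ay.
by rewrite jordan_converse; exact: phiJ.
Qed.

(** The tests of the two off-diagonal corners leave undetected the defects
    [x] with [p * x * p] and [q * x * q] opposite scalars; multiplying first
    by [p] and only then by a test breaks this symmetry. *)
Lemma additive_at_C12_C21 a b : C12 a -> C21 b -> additive_at a b.
Proof.
move=> Ca Cb; have [Aa pa ap] := Ca; have [Ab pb bp] := Cb.
have Ap := ps_p AP.
apply: (additive_at_from_defect phi_bij BD Aa Ab) => s As sab.
pose x := s - (a + b).
have dif := additive_at_defect AP phi_bij jordanMDl phiJ.
have jordan0r : forall x, additive_at x 0 by exact: (additive_at0r AP phi_bij BD jordanMDr phiJ).
have jordan0l : forall x, additive_at 0 x by exact: (additive_at0l AP phi_bij BD jordanMDr phiJ).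
have j21 t : C21 t -> b ** t = 0.
  move=> Ct; rewrite -jordan_converse.
  by apply: (@jordan_C12_C12 R^c A k p); exact: peirce21_converse.
have x12 t : C12 t -> x * t + t * x = 0.
  move=> Ct; apply: dif => //; first by case: Ct.
  by rewrite (jordan_C12_C12 k Ca Ct).
have x21 t : C21 t -> x * t + t * x = 0.
  move=> Ct; apply: dif => //; first by case: Ct.
  by rewrite (j21 _ Ct).
have xp12 t : C12 t -> (x * p + p * x) * t + t * (x * p + p * x) = 0.
  move=> Ct; have At : A t by case: Ct.
  have sp := jordan_map_split phi_bij jordanMDl phiJ As Aa Ab Ap sab.
  have ap12 : C12 (a ** p).
    by rewrite /jordan ap pa add0r; exact: (peirce12_mul_central AP).
  have J y : A y -> A (y ** p) by move=> Ay; apply/Ak/AD; exact: AM.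
  have := dif _ _ _ _ (J _ As) (J _ Aa) (J _ Ab) At sp.
  rewrite (jordan_C12_C12 k ap12 Ct) => /(_ (jordan0l _)) E.
  apply: (central_unit_eq0 AP); rewrite -[RHS]E.
  have -> : s ** p - (a ** p + b ** p) = k * (x * p + p * x).
    by rewrite /jordan /x; ncring.
  by rewrite mulrDr !mulrA (ps_central AP t).
rewrite -/x.
have qxp : q * x * p = 0.
  apply: (compl_prime_r AP) => f Af; have := x12 _ (peirce12_corner AP Af).
  move=> /(congr1 (fun y => q * y)); rewrite mulr0 => <-.
  have -> : q * (x * (p * f * q) + p * f * q * x) =
    q * x * p * f * q + q * p * f * q * x by ncring.
  by rewrite (mul_compl_idem AP) !mul0r addr0.
have pxq : p * x * q = 0.
  apply: (idem_prime_r AP) => f Af; have := x21 _ (peirce21_corner AP Af).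
  move=> /(congr1 (fun y => p * y)); rewrite mulr0 => <-.
  have -> : p * (x * (q * f * p) + q * f * p * x) =
    p * x * q * f * p + p * q * f * p * x by ncring.
  by rewrite (mul_idem_compl AP) !mul0r addr0.
have pxp : p * x * p = 0.
  apply: (compl_prime_r AP) => f Af; apply: (ps_2torsion_free AP).
  have := xp12 _ (peirce12_corner AP Af); move=> /(congr1 (fun y => p * y)).
  rewrite mulr0 => <-.
  have -> : p * ((x * p + p * x) * (p * f * q) + p * f * q * (x * p + p * x)) =
    p * x * (p * p) * f * q + p * p * x * p * f * q
    + p * p * f * (q * x * p) + p * p * f * (q * p) * x by ncring.
  by rewrite (ps_idem AP) (mul_compl_idem AP) qxp !mulr0 mul0r !addr0.
have px : p * x = 0.
  have -> : p * x = p * x * p + p * x * q by ncring.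
  by rewrite pxp pxq addr0.
have xp : x * p = 0.
  have -> : x * p = p * x * p + q * x * p by ncring.
  by rewrite pxp qxp addr0.
exact: (anticommute_C12 AP px xp).
Qed.

Lemma additive_on_offdiagonal :
  additive_on [set x | [/\ A x, p * x * p = 0 & q * x * q = 0]].
Proof.
have C12D a b : C12 a -> C12 b -> C12 (a + b).
  move=> [Aa pa ap] [Ab pb bp].
  by split; [exact: AD|rewrite mulrDr pa pb|rewrite mulrDl ap bp addr0].
have C21D a b : C21 a -> C21 b -> C21 (a + b).
  move=> [Aa pa ap] [Ab pb bp].
  by split; [exact: AD|rewrite mulrDr pa pb addr0|rewrite mulrDl ap bp].
have on12 := additive_on_C12 AP phi_bij BD jordanMDl jordanMDr phiJ.
have H := additive_on_sum C12D C21D on12 additive_on_C21 additive_at_C12_C21.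
suff dec x : [/\ A x, p * x * p = 0 & q * x * q = 0] ->
    exists a b, [/\ C12 a, C21 b & x = a + b].
  by move=> a b /dec Ha /dec Hb; exact: H.
move=> [Ax pxp qxq]; exists (p * x * q), (q * x * p); split.
- exact: (peirce12_corner AP).
- exact: (peirce21_corner AP).
- by rewrite {1}(peirce_decomposition p x) pxp qxq add0r addr0.
Qed.

Let AJ a b : A a -> A b -> A (a ** b).
Proof. by move=> Aa Ab; apply/Ak/AD; exact: AM. Qed.

Let mulqk x : q * (k * x) = k * (q * x).
Proof. by rewrite mulrA -(ps_central AP) -mulrA. Qed.

Let on_tests := additive_at_tests AP phi_bij BD jordanMDl phiJ.
Let upper := additive_on_upper AP phi_bij BD jordanMDl jordanMDr phiJ.

Let jordan_C12_upper x t : A x -> C12 t -> A (x ** t) /\ q * (x ** t) * p = 0.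
Proof.
move=> Ax [At pt tp]; split; first exact: AJ.
have qt : q * t = 0 by rewrite mulrBl mul1r pt subrr.
rewrite mulqk -mulrA.
have -> : q * (x * t + t * x) * p = q * x * (t * p) + q * t * x * p by ncring.
by rewrite tp qt !mul0r mulr0 addr0 mulr0.
Qed.

Lemma additive_on_no_corner22 : additive_on [set x | A x /\ q * x * q = 0].
Proof.
move=> a b [Aa qaq] [Ab qbq].
apply: (on_tests Aa Ab (@C12_C22_sub _ _ _)) => [x _ /(anticommute_C12_C22 AP)//|].
move=> t [Ct|Ct]; first by apply: upper; exact: jordan_C12_upper.
have [At pt tp] := Ct.
have qt : q * t = t by rewrite mulrBl mul1r pt subr0.
have tq : t * q = t by rewrite mulrBr mulr1 tp subr0.
suff J x : A x -> q * x * q = 0 ->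
    [/\ A (x ** t), p * (x ** t) * p = 0 & q * (x ** t) * q = 0].
  by apply: additive_on_offdiagonal; exact: J.
move=> Ax qxq; split; first exact: AJ.
  rewrite (idem_mul_central AP) -mulrA.
  have -> : p * (x * t + t * x) * p = p * x * (t * p) + p * t * x * p by ncring.
  by rewrite tp pt !mul0r mulr0 addr0 mulr0.
rewrite mulqk -mulrA -{1}qt -{2}tq.
have -> : q * (x * (q * t) + t * q * x) * q = q * x * q * t * q + q * t * (q * x * q)
  by ncring.
by rewrite qxq !mul0r mulr0 addr0 mulr0.
Qed.

(** Multiplying by [p] removes the corner 22, and multiplying by the corner 12
    removes the corner 21. *)
Theorem jordan_multiplicative_additive : additive_on A.
Proof.
move=> a b Aa Ab.
apply: (on_tests Aa Ab (idem_C12_sub AP)) => [x _ /(anticommute_idem_C12 AP)//|].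
move=> t [->|Ct]; last by apply: upper; exact: jordan_C12_upper.
suff J x : A x -> A (x ** p) /\ q * (x ** p) * q = 0.
  by apply: additive_on_no_corner22; exact: J.
move=> Ax; split; first by apply: AJ => //; exact: ps_p AP.
rewrite mulqk -mulrA.
have -> : q * (x * p + p * x) * q = q * x * (p * q) + q * p * x * q by ncring.
by rewrite (mul_idem_compl AP) (mul_compl_idem AP) !mul0r mulr0 addr0 mulr0.
Qed.

End AdditivityOnAlgebra.

(** * Additive Jordan maps onto a prime ring *)
Section JordanHomomorphism.
Variables (R S : pzRingType) (A : set R) (B : set S) (phi : R -> S).
Hypothesis AD : forall x y, A x -> A y -> A (x + y).
Hypothesis AN : forall x, A x -> A (- x).
Hypothesis AM : forall x y, A x -> A y -> A (x * y).
Hypothesis phiA : set_fun A B phi.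
Hypothesis phi_surj : set_surj A B phi.
Hypothesis BD : forall x y, B x -> B y -> B (x + y).
Hypothesis BN : forall x, B x -> B (- x).
Hypothesis BM : forall x y, B x -> B y -> B (x * y).
Hypothesis S2 : forall x : S, x + x = 0 -> x = 0.
Hypothesis B_prime : forall a b : S, (forall f, B f -> a * f * b = 0) ->
  a = 0 \/ b = 0.
Hypothesis phiD : forall x y, A x -> A y -> phi (x + y) = phi x + phi y.
Hypothesis phiJ : forall x y, A x -> A y ->
  phi (x * y + y * x) = phi x * phi y + phi y * phi x.

(** If [h x = f * x * g + g * x * f] vanishes identically, then so does
    [f * x * g * y * f * x * g], being half a combination of values of [h]. *)
Lemma prime_anticommute (f g : S) : B f ->
  (forall x, B x -> f * x * g + g * x * f = 0) -> f = 0 \/ g = 0.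
Proof.
move=> Bf h; apply: B_prime => x Bx.
suff [] : f * x * g = 0 \/ f * x * g = 0 by [].
apply: B_prime => y By; apply: S2.
have -> : f * x * g * y * (f * x * g) + f * x * g * y * (f * x * g) =
    f * x * (f * y * g + g * y * f) * x * g
    - (f * (x * f * y) * g + g * (x * f * y) * f) * x * g
    + (f * x * g + g * x * f) * y * f * x * g by ncring.
rewrite !h//; first ncring.
by apply: BM => //; exact: BM.
Qed.

Let double_inj (x y : S) : x + x = y + y -> x = y.
Proof.
move=> /eqP; rewrite -subr_eq0 opprD addrACA => /eqP /S2 /eqP.
by rewrite subr_eq0 => /eqP.
Qed.

Lemma jordan_sq x : A x -> phi (x * x) = phi x * phi x.
Proof.
by move=> Ax; apply: double_inj; rewrite -phiJ// phiD//; exact: AM.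
Qed.

(** Twice [x * y * x] is obtained from [x] and [y] by Jordan products alone. *)
Lemma jordan_triple x y : A x -> A y -> phi (x * y * x) = phi x * phi y * phi x.
Proof.
move=> Ax Ay; apply: double_inj.
have Axy : A (x * y) by exact: AM. have Ayx : A (y * x) by exact: AM.
have Axx : A (x * x) by exact: AM. have Axyx : A (x * y * x) by exact: AM.
have E := phiJ Ax (AD Axy Ayx); rewrite (phiJ Ax Ay) in E.
have E' : x * (x * y + y * x) + (x * y + y * x) * x =
  (x * x * y + y * (x * x)) + (x * y * x + x * y * x) by ncring.
have As : A (x * x * y + y * (x * x)) by apply: AD; exact: AM.
rewrite E' (phiD As (AD Axyx Axyx)) (phiJ Axx Ay) (jordan_sq Ax) phiD// in E.
apply: (addrI (phi x * phi x * phi y + phi y * (phi x * phi x))).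
by rewrite E; ncring.
Qed.

Lemma jordan_triple_linearized x y z : A x -> A y -> A z ->
  phi (x * y * z + z * y * x) = phi x * phi y * phi z + phi z * phi y * phi x.
Proof.
move=> Ax Ay Az.
have AM3 a b c : A a -> A b -> A c -> A (a * b * c).
  by move=> *; apply: AM => //; exact: AM.
have E := jordan_triple (AD Ax Az) Ay.
have E' : (x + z) * y * (x + z) =
  (x * y * x + z * y * z) + (x * y * z + z * y * x) by ncring.
rewrite E' (phiD (AD (AM3 _ _ _ Ax Ay Ax) (AM3 _ _ _ Az Ay Az))
  (AD (AM3 _ _ _ Ax Ay Az) (AM3 _ _ _ Az Ay Ax))) in E.
rewrite (phiD (AM3 _ _ _ Ax Ay Ax) (AM3 _ _ _ Az Ay Az)) !jordan_triple// (phiD Ax Az) in E.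
apply: (addrI (phi x * phi y * phi x + phi z * phi y * phi z)).
by rewrite E; ncring.
Qed.

(** Write [a * b * x * b * a + b * a * x * a * b] both as a sum of iterated triple
    products and as a linearized triple product of [a * b], [x], [b * a].
    Comparing the two images of it shows that the defects of [phi] from being
    multiplicative and antimultiplicative at [(a, b)] satisfy the hypothesis
    of [prime_anticommute]. *)
Lemma jordan_mul_or a b : A a -> A b ->
  phi (a * b) = phi a * phi b \/ phi (a * b) = phi b * phi a.
Proof.
move=> Aa Ab.
have Aab : A (a * b) by exact: AM. have Aba : A (b * a) by exact: AM.
have Eba : phi (b * a) = phi a * phi b + phi b * phi a - phi (a * b).
  by rewrite -phiJ// phiD// [X in X - _]addrC addrK.
have BB x y : A x -> A y -> B (phi x * phi y) by move=> *; apply: BM; exact: phiA.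
have [] := @prime_anticommute (phi (a * b) - phi a * phi b)
  (phi (a * b) - phi b * phi a).
- by apply: BD; [exact: phiA|apply: BN; exact: BB].
- move=> _ /phi_surj [x Ax <-].
  have Abxb : A (b * x * b) by do 2 apply: AM => //.
  have Aaxa : A (a * x * a) by do 2 apply: AM => //.
  have E : a * (b * x * b) * a + b * (a * x * a) * b =
    a * b * x * (b * a) + b * a * x * (a * b) by ncring.
  move: (congr1 phi E); rewrite jordan_triple_linearized//.
  rewrite phiD; try by do 2 apply: AM => //.
  rewrite !jordan_triple// Eba => {}E.
  have -> : (phi (a * b) - phi a * phi b) * phi x * (phi (a * b) - phi b * phi a)
    + (phi (a * b) - phi b * phi a) * phi x * (phi (a * b) - phi a * phi b) =
    phi a * (phi b * phi x * phi b) * phi a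
    + phi b * (phi a * phi x * phi a) * phi b
    - (phi (a * b) * phi x * (phi a * phi b + phi b * phi a - phi (a * b)) +
      (phi a * phi b + phi b * phi a - phi (a * b)) * phi x * phi (a * b)).
    by ncring.
  by rewrite E subrr.
- by move/eqP; rewrite subr_eq0 => /eqP; left.
- by move/eqP; rewrite subr_eq0 => /eqP; right.
Qed.

Let AB x y : A x -> A y -> A (x - y).
Proof. by move=> Ax Ay; apply: AD => //; exact: AN. Qed.

Let phiB x y : A x -> A y -> phi (x - y) = phi x - phi y.
Proof.
move=> Ax Ay; apply: (addIr (phi y)).
by rewrite subrK -phiD ?subrK//; exact: AB.
Qed.

Lemma union_of_subgroups (P Q : R -> Prop) :
  (forall x y, A x -> A y -> P x -> P y -> P (x - y)) ->
  (forall x y, A x -> A y -> Q x -> Q y -> Q (x - y)) ->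
  (forall x, A x -> P x \/ Q x) ->
  (forall x, A x -> P x) \/ (forall x, A x -> Q x).
Proof.
move=> PB QB PQ.
have [|] := pselect (forall x, A x -> P x); first by left.
move=> /existsNP [x /not_implyP [Ax nPx]]; right => y Ay.
have [Py|//] := PQ y Ay; have [//|Qx] := PQ x Ax.
have [Pxy|Qxy] := PQ _ (AD Ax Ay).
  by case: nPx; rewrite -(addrK y x); apply: PB => //; exact: AD.
by rewrite -(addrK x y) [y + x]addrC; apply: QB => //; exact: AD.
Qed.

Theorem jordan_hom_or_antihom :
  (forall x y, A x -> A y -> phi (x * y) = phi x * phi y) \/
  (forall x y, A x -> A y -> phi (x * y) = phi y * phi x).
Proof.
pose hom a b := phi (a * b) = phi a * phi b.
pose anti a b := phi (a * b) = phi b * phi a.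
suff [H|H] : (forall a, A a -> forall b, A b -> hom a b) \/
    (forall a, A a -> forall b, A b -> anti a b).
- by left => x y Ax Ay; exact: H.
- by right => x y Ax Ay; exact: H.
apply: union_of_subgroups => [a b Aa Ab Pa Pb y Ay|a b Aa Ab Qa Qb y Ay|a Aa].
- by rewrite /hom mulrBl !phiB ?Pa ?Pb ?mulrBl//; exact: AM.
- by rewrite /anti mulrBl !phiB ?Qa ?Qb ?mulrBr//; exact: AM.
apply: union_of_subgroups => [x y Ax Ay Px Py|x y Ax Ay Qx Qy|b Ab].
- by rewrite /hom mulrBr !phiB ?Px ?Py ?mulrBr//; exact: AM.
- by rewrite /anti mulrBr !phiB ?Qx ?Qy ?mulrBl//; exact: AM.
- exact: jordan_mul_or.
Qed.
End JordanHomomorphism.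

(** * The ring of operators with a formal adjoint *)
Section AdjointableOperators.
Variables (K : realType) (H : completeNormedModType K[i]).
Variables (dot : {dot H for Num.conj}) (D : submodClosed H).

Local Notation C := K[i].
Local Notation V := (carrier D).
Local Notation op := (V -> V).

Definition ip (x y : V) : C := dot (val x) (val y).

Lemma ipDl x y z : ip (x + y) z = ip x z + ip y z.
Proof. by rewrite /ip GRing.valD linearDl. Qed.

Lemma ipDr x y z : ip x (y + z) = ip x y + ip x z.
Proof. by rewrite /ip GRing.valD linearDr. Qed.

Lemma ipZl c x y : ip (c *: x) y = c * ip x y.
Proof. by rewrite /ip GRing.valZ linearZl_LR. Qed.

Lemma ipZr c x y : ip x (c *: y) = Num.conj c * ip x y.
Proof. by rewrite /ip GRing.valZ linearZr_LR. Qed.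

Lemma ip0l y : ip 0 y = 0.
Proof. by rewrite -[0](scale0r (0 : V)) ipZl mul0r. Qed.

Lemma ip0r y : ip y 0 = 0.
Proof. by rewrite -[X in ip _ X](scale0r (0 : V)) ipZr rmorph0 mul0r. Qed.

Lemma ipNl x y : ip (- x) y = - ip x y.
Proof. by rewrite -scaleN1r ipZl mulN1r. Qed.

Lemma ipNr x y : ip x (- y) = - ip x y.
Proof. by rewrite -scaleN1r ipZr rmorphN rmorph1 mulN1r. Qed.

Lemma ipC x y : ip x y = Num.conj (ip y x).
Proof. by rewrite /ip hermC expr0 mul1r. Qed.

Lemma conj_ip_inv x : Num.conj (ip x x)^-1 = (ip x x)^-1.
Proof. by rewrite fmorphV; congr (_^-1); exact/esym/ipC. Qed.

Lemma ip_eq0 x : (ip x x == 0) = (x == 0).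
Proof. by rewrite /ip dnorm_eq0 -(inj_eq val_inj) GRing.val0. Qed.

Lemma ip_injl x y : (forall z, ip x z = ip y z) -> x = y.
Proof.
move=> h; apply/eqP; rewrite -subr_eq0 -ip_eq0.
by rewrite ipDl ipNl h subrr.
Qed.

Definition formal_adjoint (A A' : op) :=
  forall x y, ip (A x) y = ip x (A' y).

Definition adjointable : set op := [set A | exists A', formal_adjoint A A'].

Lemma formal_adjointC A A' : formal_adjoint A A' -> formal_adjoint A' A.
Proof. by move=> h x y; rewrite ipC -h -ipC. Qed.

Lemma formal_adjoint_linear A A' : formal_adjoint A A' -> linear A.
Proof.
move=> h c x y; apply: ip_injl => z.
by rewrite h !ipDl !ipZl !h.
Qed.

Lemma formal_adjointD A A' B B' : formal_adjoint A A' -> formal_adjoint B B' ->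
  formal_adjoint (A + B) (A' + B').
Proof. by move=> hA hB x y; rewrite ipDl hA hB ipDr. Qed.

Lemma formal_adjointZ c A A' : formal_adjoint A A' ->
  formal_adjoint (c *: A) (Num.conj c *: A').
Proof. by move=> hA x y; rewrite ipZl hA ipZr conjCK. Qed.

Lemma formal_adjoint_comp A A' B B' : formal_adjoint A A' ->
  formal_adjoint B B' -> formal_adjoint (A \o B) (B' \o A').
Proof. by move=> hA hB x y /=; rewrite hA hB. Qed.

Lemma formal_adjoint_scale c : formal_adjoint ( *:%R c) ( *:%R (Num.conj c)).
Proof. by move=> x y; rewrite ipZl ipZr conjCK. Qed.

Definition rank_one (x y : V) : op := fun z => ip z y *: x.

Lemma formal_adjoint_rank_one x y :
  formal_adjoint (rank_one x y) (rank_one y x).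
Proof. by move=> z w; rewrite ipZl ipZr -ipC mulrC. Qed.

Definition adjointableb : {pred op} := fun A => `[< adjointable A >].
(** An operator with a formal adjoint is automatically linear, so this subtype of
    the space of all functions is a ring under composition. *)
Definition adjop := {A : op | adjointableb A}.

Lemma adjointable_zmod : zmod_closed adjointableb.
Proof.
split; first by apply/asboolP; exists 0 => x y; rewrite ip0l ip0r.
move=> A B /asboolP [A' hA] /asboolP [B' hB]; apply/asboolP.
exists (A' + (- 1) *: B'); rewrite -scaleN1r.
apply: formal_adjointD => //.
by have := formal_adjointZ (-1) hB; rewrite rmorphN rmorph1.
Qed.

HB.instance Definition _ :=
  GRing.isZmodClosed.Build op adjointableb adjointable_zmod.
HB.instance Definition _ := SubChoice.on adjop.
HB.instance Definition _ := [SubChoice_isSubZmodule of adjop by <:].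

Lemma adjopP (a : adjop) : adjointable (val a).
Proof. by apply/asboolP; exact: (valP a). Qed.

Definition mk_adjop (A : op) (hA : adjointable A) : adjop :=
  exist _ A (asboolT hA).

Lemma adjop_linear (a : adjop) : linear (val a).
Proof. by have [A' /formal_adjoint_linear] := adjopP a. Qed.

Lemma adjopDx (a : adjop) (x y : V) : val a (x + y) = val a x + val a y.
Proof. by have := @adjop_linear a 1 x y; rewrite !scale1r. Qed.

Lemma adjopx0 (a : adjop) : val a 0 = 0.
Proof. by apply: (addrI (val a 0)); rewrite -adjopDx !addr0. Qed.

Lemma adjopZx (a : adjop) c (x : V) : val a (c *: x) = c *: val a x.
Proof. by have := @adjop_linear a c x 0; rewrite adjopx0 !addr0. Qed.

Lemma adjointable_comp A B : adjointable A -> adjointable B ->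
  adjointable (A \o B).
Proof. by move=> [A' hA] [B' hB]; exists (B' \o A'); exact: formal_adjoint_comp. Qed.

Lemma adjointable_id : adjointable idfun.
Proof. by exists idfun. Qed.

Definition adjop_one : adjop := mk_adjop adjointable_id.
Definition adjop_mul (a b : adjop) : adjop :=
  mk_adjop (adjointable_comp (adjopP a) (adjopP b)).

Lemma adjop_mulA : associative adjop_mul.
Proof. by move=> a b c; apply: val_inj. Qed.
Lemma adjop_mul1r : left_id adjop_one adjop_mul.
Proof. by move=> a; apply: val_inj. Qed.
Lemma adjop_mulr1 : right_id adjop_one adjop_mul.
Proof. by move=> a; apply: val_inj. Qed.
Lemma adjop_mulDl : left_distributive adjop_mul +%R.
Proof. by move=> a b c; apply: val_inj. Qed.
Lemma adjop_mulDr : right_distributive adjop_mul +%R.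
Proof.
move=> a b c; apply: val_inj; apply/funext => x.
have -> : val (adjop_mul a (b + c)) x = val a (val b x + val c x) by [].
by rewrite adjopDx.
Qed.

HB.instance Definition _ := GRing.Zmodule_isPzRing.Build adjop
  adjop_mulA adjop_mul1r adjop_mulr1 adjop_mulDl adjop_mulDr.

Lemma adjop_valD (a b : adjop) : val (a + b) = val a + val b.
Proof. by []. Qed.

Lemma adjopMx (a b : adjop) x : val (a * b) x = val a (val b x).
Proof. by []. Qed.

Definition adjop_scale (c : C) : adjop :=
  mk_adjop (ex_intro _ _ (formal_adjoint_scale c)).

Definition adjop_rank_one x y : adjop :=
  mk_adjop (ex_intro _ _ (formal_adjoint_rank_one x y)).

Hypothesis dim_gt1 : ~ spanned_by V 1.

Lemma nonzero_ex : exists x : V, x <> 0.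
Proof.
apply: contrapT => /forallNP all0; apply: dim_gt1.
exists (fun=> 0) => x; exists (fun=> 0).
by rewrite big_ord1 scaler0; apply: contrapT; exact: all0.
Qed.

(** The orthogonal projection onto the line spanned by [x], which is the zero
    operator when [x = 0]. *)
Definition line_proj x := adjop_rank_one ((ip x x)^-1 *: x) x.

Lemma line_projE x z : val (line_proj x) z = (ip z x / ip x x) *: x.
Proof. by rewrite /= /rank_one scalerA. Qed.

Lemma line_proj_id x : val (line_proj x) x = x.
Proof.
rewrite line_projE; have [->|x0] := eqVneq x 0; first by rewrite scaler0.
by rewrite divff ?scale1r// ip_eq0.
Qed.

Lemma line_proj_idem x : line_proj x * line_proj x = line_proj x.
Proof.
apply: val_inj; apply/funext => z; rewrite adjopMx.
by rewrite [val (line_proj x) z]line_projE adjopZx line_proj_id.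
Qed.

Lemma line_proj_orth x z : ip z x = 0 -> val (line_proj x) z = 0.
Proof. by rewrite line_projE => ->; rewrite mul0r scale0r. Qed.

Lemma line_proj_neq1 x : line_proj x <> 1.
Proof.
move=> e; apply: dim_gt1; exists (fun=> x) => z; exists (fun=> ip z x / ip x x).
by rewrite big_ord1 -line_projE e.
Qed.

Lemma line_proj_neq0 x : x <> 0 -> line_proj x <> 0.
Proof. by move=> x0 e; apply: x0; rewrite -(line_proj_id x) e. Qed.

Definition has_rank_ones (A : set adjop) := forall x y, A (adjop_rank_one x y).

(** For [f = rank_one x (b y)] the value of [a * f * b] at [y] is a multiple of [a x]
    by the squared norm of [b y]. *)
Lemma rank_one_prime (A : set adjop) : has_rank_ones A ->
  forall a b, (forall f, A f -> a * f * b = 0) -> a = 0 \/ b = 0.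
Proof.
move=> A1 a b h; have [->|/eqP b0] := pselect (b = 0); first by right.
left; have [y by0] : exists y, val b y <> 0.
  apply: contrapT => /forallNP ball0; apply/negP: b0; rewrite negbK; apply/eqP.
  by apply: val_inj; apply/funext => y; apply: contrapT; exact: ball0.
apply: val_inj; apply/funext => x.
have := congr1 (fun c : adjop => val c y) (h _ (A1 x (val b y))).
rewrite !adjopMx [val (adjop_rank_one _ _) _]/= /rank_one adjopZx => /eqP.
by rewrite scaler_eq0 ip_eq0 => /orP[/eqP//|/eqP].
Qed.

Lemma adjop_two (a : adjop) : a + a = 0 -> a = 0.
Proof.
move=> /(congr1 val) h; apply: val_inj; apply/funext => x.
have /eqP : val a x + val a x = 0 := congr1 (fun f : op => f x) h.
by rewrite -mulr2n -scaler_nat scaler_eq0 pnatr_eq0 => /eqP.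
Qed.

Lemma adjop_scale_central c a : adjop_scale c * a = a * adjop_scale c.
Proof. by apply: val_inj; apply/funext => x; rewrite adjopMx /= adjopZx. Qed.

(** The local unit of an element [a] of the corner 12 is the projection onto the
    line of [a^+ x], and that of the corner 21 the projection onto the line
    of [a x]. *)
Lemma adjop_peirce_setting (A : set adjop) (c : C) (x : V) : c != 0 -> x <> 0 ->
  (forall a b, A a -> A b -> A (a + b)) ->
  (forall a b, A a -> A b -> A (a * b)) ->
  (forall c a, A a -> A (adjop_scale c * a)) ->
  has_rank_ones A ->
  peirce_setting A (adjop_scale c) (line_proj x).
Proof.
move=> c0 x0 AD AM AZ A1; split=> //.
- exact: adjop_scale_central.
- exists (adjop_scale c^-1); split.
  + by apply: val_inj; apply/funext => z; rewrite adjopMx /= scalerA divff// scale1r.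
  + exact: adjop_scale_central.
  + exact: AZ.
- exact: adjop_two.
- move=> a Aa; suff -> : - a = adjop_scale (- 1) * a by exact: AZ.
  by apply: val_inj; apply/funext => z; rewrite adjopMx /= scaleN1r.
- exact: AZ.
- exact: A1.
- exact: line_proj_idem.
- exact: line_proj_neq0.
- exact: line_proj_neq1.
- exact: rank_one_prime.
- move=> a Aa pa ap; have [a' ha] := adjopP a.
  have ax : val a x = 0.
    by rewrite -{1}(line_proj_id x); have := congr1 (fun b : adjop => val b x) ap.
  have aE z : val a z = (ip z (a' x) / ip x x) *: x.
    by rewrite -ha -line_projE; have /esym := congr1 (fun b : adjop => val b z) pa.
  have xy : ip x (a' x) = 0 by rewrite -ha ax ip0l.
  exists (line_proj (a' x)); split.
  + exact: A1.
  + apply: val_inj; apply/funext => z; rewrite adjopMx [val (line_proj (a' x)) z]line_projE adjopZx.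
    by rewrite line_proj_orth ?scaler0// ipC xy rmorph0.
  + apply: val_inj; apply/funext => z; rewrite adjopMx [val (line_proj x) z]line_projE adjopZx.
    by rewrite line_proj_orth ?scaler0.
  + apply: val_inj; apply/funext => z; rewrite adjopMx [val (line_proj (a' x)) z]line_projE adjopZx.
    rewrite !aE scalerA; congr (_ *: _).
    have [->|y0] := eqVneq (a' x) 0; first by rewrite !ip0r !mul0r.
    by rewrite mulrA divfK// ip_eq0.
- move=> a Aa pa ap.
  have xz : ip (val a x) x = 0.
    have : val (line_proj x) (val a x) = 0.
      by have := congr1 (fun b : adjop => val b x) pa.
    rewrite line_projE => /eqP; rewrite scaler_eq0 mulf_eq0 invr_eq0 ip_eq0.
    by move/eqP: x0 => /negbTE ->; rewrite !orbF => /eqP.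
  exists (line_proj (val a x)); split.
  + exact: A1.
  + apply: val_inj; apply/funext => z; rewrite adjopMx [val (line_proj (val a x)) z]line_projE adjopZx.
    by rewrite line_proj_orth ?scaler0.
  + apply: val_inj; apply/funext => z; rewrite adjopMx [val (line_proj x) z]line_projE adjopZx.
    by rewrite line_proj_orth ?scaler0// ipC xz rmorph0.
  + apply: val_inj; apply/funext => z; rewrite adjopMx.
    have -> : val a z = (ip z x / ip x x) *: val a x.
      by rewrite -{1}ap adjopMx line_projE adjopZx.
    by rewrite adjopZx line_proj_id.
Qed.

End AdjointableOperators.

(** * Standard operator algebras *)
Section OperatorAlgebra.
Variables (K : realType) (H : completeNormedModType K[i]).
Variables (dot : {dot H for Num.conj}) (D : submodClosed H).

Local Notation C := K[i].
Local Notation V := (carrier D).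
Local Notation op := (V -> V).
Local Notation adjop := (adjop dot D).

(** The properties of standard operator algebras that pass to their image under
    the dagger by mere inspection. *)
Record operator_algebra (AA : set op) : Prop := {
  oa_adjointable : forall A, AA A -> adjointable dot A;
  oa_rank_one : forall x y, AA (rank_one dot x y);
  oa_D : forall A B, AA A -> AA B -> AA (A + B);
  oa_Z : forall (c : C) A, AA A -> AA (c *: A);
  oa_M : forall A B, AA A -> AA B -> AA (A \o B)
}.

Definition lifted (F : set op) : set adjop := [set a | F (val a)].

Variable AA : set op.
Hypothesis algA : operator_algebra AA.

Lemma lifted_rank_ones : has_rank_ones (lifted AA).
Proof. by move=> x y; exact: oa_rank_one algA x y. Qed.

Lemma lifted_D a b : lifted AA a -> lifted AA b -> lifted AA (a + b).
Proof. exact: oa_D. Qed.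

Lemma lifted_M a b : lifted AA a -> lifted AA b -> lifted AA (a * b).
Proof. exact: oa_M. Qed.

Lemma lifted_scale c a : lifted AA a -> lifted AA (adjop_scale dot D c * a).
Proof. exact: oa_Z. Qed.

Lemma lifted_N a : lifted AA a -> lifted AA (- a).
Proof.
move=> Aa; suff -> : - a = adjop_scale dot D (- 1) * a by exact: lifted_scale.
by apply: val_inj; apply/funext => z; rewrite adjopMx /= scaleN1r.
Qed.

End OperatorAlgebra.
Arguments lifted {K H} dot {D} F.

Section GraphSpaceOperators.
Variables (K : realType) (H : completeNormedModType K[i]).
Variables (dot : {dot H for Num.conj}).
Hypothesis hdot : forall x : H, `|x| ^+ 2 = dot x x.
Variable D : submodClosed H.
Hypothesis denseD : dense [set x : H | x \in D].

Local Notation C := K[i].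
Local Notation V := (carrier D).
Local Notation op := (V -> V).
Local Notation ip := (ip dot (D := D)).
Local Notation adjop := (adjop dot D).
Local Notation formal_adjoint := (formal_adjoint dot (D := D)).

(** If [z] were nonzero, some [y] of the dense subspace would satisfy
    [|z - y| < |z|], whereas [|z - y|^2 = |z|^2 + |y|^2]. *)
Lemma dense_orthogonal_eq0 (z : H) : (forall x : V, dot (val x) z = 0) -> z = 0.
Proof.
move=> h; apply: contrapT => /eqP z0.
have [] := denseD (O := ball z `|z|).
- by exists z; apply: ballxx; rewrite normr_gt0.
- exact: ball_open.
move=> y [zy /= yD].
have dyz : dot y z = 0 := h (exist _ y yD).
have dzy : dot z y = 0.
  have -> : dot z y = Num.conj (dot y z) by rewrite [LHS]hermC expr0 mul1r.
  by rewrite dyz rmorph0.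
have : `|z - y| ^+ 2 < `|z| ^+ 2.
  by rewrite ltr_pXn2r ?nnegrE//; move: zy; rewrite -ball_normE.
rewrite !hdot dnormB /= dzy rmorph0 addr0 subr0.
by rewrite gtrDl => /lt_geF; rewrite dnorm_ge0.
Qed.

Lemma Lplus_dagger (A : op) : Lplus dot A -> formal_adjoint A (dagger dot A).
Proof.
move=> [_ h] x y; have [[z hz] AyD] := h y.
by rewrite /ip insubdK//; exact: (xgetPex 0 (ex_intro _ z hz)).
Qed.

Lemma formal_adjoint_adjoint (A A' : op) (y : V) : formal_adjoint A A' ->
  adjoint dot A (val y) = val (A' y).
Proof.
move=> h; rewrite /adjoint.
have r : adjoint_rel dot A (val y) (val (A' y)) by move=> x; exact: h.
apply/eqP; rewrite -subr_eq0; apply/eqP/dense_orthogonal_eq0 => x.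
have dotB u v w : dot w (u - v) = dot w u - dot w v by exact: linearBr.
rewrite dotB -[X in _ - X](r x); apply/eqP; rewrite subr_eq0; apply/eqP/esym.
exact: (xgetPex 0 (ex_intro _ _ r) x).
Qed.

(** Density makes the adjoint of [y] unique in [H], so that it suffices to find it
    inside the domain. *)
Lemma LplusE (A : op) : Lplus dot A <-> adjointable dot A.
Proof.
split=> [hA|[A' hA]]; first by exists (dagger dot A); exact: Lplus_dagger.
split=> [|y]; first exact: formal_adjoint_linear hA.
split; first by exists (val (A' y)) => x; exact: hA.
by rewrite (formal_adjoint_adjoint _ hA); exact: (valP (A' y)).
Qed.

Lemma daggerE (A A' : op) : formal_adjoint A A' -> dagger dot A = A'.
Proof.
move=> hA; apply/funext => y; apply: val_inj.
by rewrite /dagger (formal_adjoint_adjoint _ hA) valKd.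
Qed.

Lemma daggerP (A : op) : adjointable dot A -> formal_adjoint A (dagger dot A).
Proof. by move=> /LplusE /Lplus_dagger. Qed.

Lemma standard_operator_algebraW (AA : set op) : standard_operator_algebra dot AA ->
  operator_algebra dot AA.
Proof.
case=> AAL AAF AAD AAZ AAM; split=> // [A /AAL /LplusE//|x y].
apply: AAF; split.
  by apply/LplusE; exists (rank_one dot y x); exact: formal_adjoint_rank_one.
by exists 1%N, (fun=> x) => z; exists (fun=> ip z y); rewrite big_ord1.
Qed.

End GraphSpaceOperators.

(** * Jordan maps are isomorphisms or antiisomorphisms *)
Section JordanMaps.
Variables (K : realType) (H : completeNormedModType K[i]).
Variables (dot : {dot H for Num.conj}).
Variable D : submodClosed H.
Hypothesis dim_gt1 : ~ spanned_by (carrier D) 1.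

Local Notation C := K[i].
Local Notation V := (carrier D).
Local Notation op := (V -> V).
Local Notation ip := (ip dot (D := D)).
Local Notation adjop := (adjop dot D).

Lemma additive_ratrZ (A : set op) (f : op -> op) :
  (forall x y, A x -> A y -> A (x + y)) -> (forall c x, A x -> A (c *: x)) ->
  (forall x y, A x -> A y -> f (x + y) = f x + f y) ->
  forall (r : rat) x, A x -> f (ratr r *: x) = (ratr r : C) *: f x.
Proof.
move=> AD AZ fD r x Ax.
have A0 : A 0 by rewrite -(scale0r x); exact: AZ.
have f0 : f 0 = 0 by apply: (addrI (f 0)); rewrite -fD// !addr0.
have fN y : A y -> f (- y) = - f y.
  move=> Ay; apply: (addrI (f y)); rewrite -fD ?subrr//.
  by rewrite -scaleN1r; exact: AZ.
have fMn y n : A y -> f (y *+ n) = f y *+ n.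
  move=> Ay; elim: n => [|n IHn]; first by rewrite !mulr0n.
  by rewrite !mulrS fD ?IHn// -scaler_nat; exact: AZ.
have fMz y m : A y -> f (y *~ m) = f y *~ m.
  move=> Ay; case: m => n; first exact: fMn.
  by rewrite NegzE !mulrNz fN ?fMn// -pmulrn -scaler_nat; exact: AZ.
have d0 : (denq r)%:~R != 0 :> C by rewrite intr_eq0 denq_eq0.
apply: (scalerI d0); rewrite !scaler_int -fMz; last exact: AZ.
rewrite -[_ *~ _ in LHS]scaler_int -[_ *~ _ in RHS]scaler_int !scalerA.
have -> : (denq r)%:~R * ratr r = (numq r)%:~R :> C.
  by rewrite /ratr mulrC divfK.
by rewrite !scaler_int fMz.
Qed.

Variables AA BB : set op.
Hypothesis algA : operator_algebra dot AA.
Hypothesis algB : operator_algebra dot BB.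
Variable Phi : op -> op.

Definition lift_map (a : adjop) : adjop := insubd 0 (Phi (val a)).

Lemma val_lift_map a : set_fun AA BB Phi -> lifted dot AA a ->
  val (lift_map a) = Phi (val a).
Proof.
move=> PhiAB Aa; apply: insubdK; apply/asboolP.
exact: (oa_adjointable algB (PhiAB _ Aa)).
Qed.

Lemma lift_map_bij : set_bij AA BB Phi ->
  set_bij (lifted dot AA) (lifted dot BB) lift_map.
Proof.
move=> [PhiAB inj surj]; split.
- by move=> a Aa; rewrite /lifted /= val_lift_map//; exact: PhiAB.
- move=> a b /set_mem Aa /set_mem Ab /(congr1 val); rewrite !val_lift_map//.
  by move=> /inj e; apply: val_inj; apply: e; exact: mem_set.
- move=> b Bb; have [A AA_A PhiA] := surj _ Bb.
  have hA := oa_adjointable algA AA_A.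
  exists (mk_adjop hA) => //.
  by apply: val_inj; rewrite val_lift_map.
Qed.

Hypothesis jordanPhi : k_Jordan_map AA BB Phi.

Lemma jordan_map_additive : forall A B, AA A -> AA B ->
  Phi (A + B) = Phi A + Phi B.
Proof.
have [bij [k k0 PhiJ]] := jordanPhi; have [PhiAB _ _] := bij.
have [x x0] := nonzero_ex dim_gt1.
have kC0 : (ratr k : C) != 0 by rewrite fmorph_eq0.
have AP := adjop_peirce_setting dim_gt1 kC0 x0 (lifted_D algA) (lifted_M algA)
  (lifted_scale algA) (lifted_rank_ones algA).
have phiJ a b : lifted dot AA a -> lifted dot AA b ->
    lift_map (jordan (adjop_scale dot D (ratr k)) a b) =
    jordan (adjop_scale dot D (ratr k)) (lift_map a) (lift_map b).
  have valJ u v : val (jordan (adjop_scale dot D (ratr k)) u v) =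
      (ratr k : C) *: ((val u \o val v) + (val v \o val u)).
    by [].
  move=> Aa Ab; apply: val_inj; rewrite val_lift_map//.
    rewrite !valJ.
    by rewrite PhiJ// -[Phi (val a)]val_lift_map// -[Phi (val b)]val_lift_map.
  by apply: (lifted_scale algA); apply: (lifted_D algA); exact: (lifted_M algA).
have jDl u v w : lifted dot BB u -> lifted dot BB v -> lifted dot BB w ->
    jordan (adjop_scale dot D (ratr k)) (u + v) w =
    jordan (adjop_scale dot D (ratr k)) u w +
    jordan (adjop_scale dot D (ratr k)) v w by move=> *; exact: jordanDl.
have jDr u v w : lifted dot BB u -> lifted dot BB v -> lifted dot BB w ->
    jordan (adjop_scale dot D (ratr k)) w (u + v) =
    jordan (adjop_scale dot D (ratr k)) w u +
    jordan (adjop_scale dot D (ratr k)) w v.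
  by move=> *; exact: jordanDr.
have add := jordan_multiplicative_additive AP (lift_map_bij bij) (lifted_D algB) jDl jDr phiJ.
move=> A B AA_A AA_B.
have hA := oa_adjointable algA AA_A.
have hB := oa_adjointable algA AA_B.
pose a := mk_adjop hA; pose b := mk_adjop hB.
have Aab : lifted dot AA (a + b) by exact: (lifted_D algA).
rewrite -[A]/(val a) -[B]/(val b) -[X in Phi X]/(val (a + b)).
by rewrite -!val_lift_map// -adjop_valD; congr val; exact: (add a b AA_A AA_B).
Qed.

Theorem jordan_map_iso_or_antiiso :
  ring_isomorphism AA BB Phi \/ ring_antiisomorphism AA BB Phi.
Proof.
have [bij [k k0 PhiJ]] := jordanPhi; have [PhiAB _ surj] := bij.
have phiD := jordan_map_additive.
have [_ _ AD AZ AM] := algA; have [_ _ BD BZ BM] := algB.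
have kC0 : (ratr k : C) != 0 by rewrite fmorph_eq0.
have PhiJ1 A B : AA A -> AA B ->
    Phi ((A \o B) + (B \o A)) = (Phi A \o Phi B) + (Phi B \o Phi A).
  move=> hA hB; apply: (scalerI kC0).
  by rewrite -PhiJ// (additive_ratrZ AD AZ phiD)//; apply: AD; exact: AM.
have phi_add a b : lifted dot AA a -> lifted dot AA b ->
    lift_map (a + b) = lift_map a + lift_map b.
  move=> Aa Ab; apply: val_inj; rewrite adjop_valD !val_lift_map//.
    by rewrite adjop_valD phiD.
  exact: (lifted_D algA).
have phiJ a b : lifted dot AA a -> lifted dot AA b ->
    lift_map (a * b + b * a) = lift_map a * lift_map b + lift_map b * lift_map a.
  move=> Aa Ab; apply: val_inj.
  have valJ (u v : adjop) :
      val (u * v + v * u) = (val u \o val v) + (val v \o val u) by [].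
  have Aab : lifted dot AA (a * b + b * a).
    by apply: (lifted_D algA); exact: (lifted_M algA).
  by rewrite (val_lift_map PhiAB Aab) !valJ PhiJ1// !val_lift_map.
have [lA _ lsurj] := lift_map_bij bij.
have homE (A B : op) (h : AA A) (h' : AA B) :
    let a := mk_adjop (oa_adjointable algA h) in
    let b := mk_adjop (oa_adjointable algA h') in
    [/\ val (lift_map (a * b)) = Phi (A \o B), val (lift_map a) = Phi A &
        val (lift_map b) = Phi B].
  by move=> a b; split; rewrite val_lift_map//; exact: AM.
have [hom|anti] := jordan_hom_or_antihom (lifted_D algA) (lifted_N algA)
    (lifted_M algA) lA lsurj (lifted_D algB) (lifted_N algB) (lifted_M algB)
    (@adjop_two _ _ _ _) (rank_one_prime (lifted_rank_ones algB))
    phi_add phiJ.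
- left; split=> // A B h h'; have [<- <- <-] := homE A B h h'.
  by rewrite hom.
- right; split=> // A B h h'; have [<- <- <-] := homE A B h h'.
  by rewrite anti.
Qed.
End JordanMaps.

(** * Semilinear implementation of isomorphisms *)
Section SpatialImplementation.
Variables (K : realType) (H : completeNormedModType K[i]).
Variables (dot : {dot H for Num.conj}) (D : submodClosed H).

Local Notation C := K[i].
Local Notation V := (carrier D).
Local Notation op := (V -> V).
Local Notation ip := (ip dot (D := D)).
Local Notation rank_one := (rank_one dot (D := D)).
Local Notation formal_adjoint := (formal_adjoint dot (D := D)).

Variables AA BB : set op.
Hypothesis algA : operator_algebra dot AA.
Hypothesis algB : operator_algebra dot BB.

Lemma oa_linear A : AA A -> linear A.
Proof. by move=> /(oa_adjointable algA) [A' /formal_adjoint_linear]. Qed.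

Lemma rank_oneDl x y z : rank_one (x + y) z = rank_one x z + rank_one y z.
Proof. by apply/funext => w; exact: scalerDr. Qed.

Lemma rank_oneZl c x z : rank_one (c *: x) z = c *: rank_one x z.
Proof. by apply/funext => w; rewrite /rank_one scalerA mulrC -scalerA. Qed.

Lemma rank_one0l z : rank_one 0 z = 0.
Proof. by apply/funext => w; exact: scaler0. Qed.

Lemma comp_rank_one A x y : linear A -> A \o rank_one x y = rank_one (A x) y.
Proof.
move=> lA; apply/funext => z /=; rewrite /rank_one.
have A0 : A 0 = 0.
  have /eqP := lA 1 0 0; rewrite !scale1r addr0 -subr_eq0 opprD addNKr oppr_eq0.
  by move/eqP.
by rewrite -[_ *: x]addr0 lA A0 addr0.
Qed.

Definition semilinear_map (tau : C -> C) (T : op) :=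
  (forall x y, T (x + y) = T x + T y) /\
  (forall c x, T (c *: x) = tau c *: T x).

Variable Phi : op -> op.
Hypothesis iso : ring_isomorphism AA BB Phi.

Let PhiAB : set_fun AA BB Phi. Proof. by case: iso => [[[]]]. Qed.
Let PhiD A B : AA A -> AA B -> Phi (A + B) = Phi A + Phi B.
Proof. by case: iso => [[_ +] _]; exact. Qed.
Let PhiM A B : AA A -> AA B -> Phi (A \o B) = Phi A \o Phi B.
Proof. by case: iso => [_]; exact. Qed.
Let Phi_surj B : BB B -> exists2 A, AA A & Phi A = B.
Proof. by case: iso => [[[_ _ +] _] _] => /[apply] -[A]; exists A. Qed.
Let Phi_inj A B : AA A -> AA B -> Phi A = Phi B -> A = B.
Proof.
case: iso => [[[_ inj _] _] _] hA hB; apply: inj; exact: mem_set.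
Qed.
Let AA0 : AA 0.
Proof. by rewrite -(rank_one0l 0); exact: (oa_rank_one algA). Qed.
Let Phi0 : Phi 0 = 0.
Proof. by apply: (addrI (Phi 0)); rewrite -PhiD// !addr0. Qed.
Let BB_linear A : AA A -> linear (Phi A).
Proof. by move=> /PhiAB /(oa_adjointable algB) [A' /formal_adjoint_linear]. Qed.
Let PhiDx A x y : AA A -> Phi A (x + y) = Phi A x + Phi A y.
Proof. by move=> /BB_linear lA; have := lA 1 x y; rewrite !scale1r. Qed.
Let Phix0 A : AA A -> Phi A 0 = 0.
Proof.
by move=> hA; apply: (addrI (Phi A 0)); rewrite -PhiDx// !addr0.
Qed.
Let PhiZx A c x : AA A -> Phi A (c *: x) = c *: Phi A x.
Proof.
by move=> hA; have := BB_linear hA c x 0; rewrite Phix0// !addr0.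
Qed.

(** Let [P] be a rank one idempotent and [Q = Phi P], with [Q u = u].  The
    preimage [A] of [rank_one u u] satisfies [P A P = lam P], so that
    [Q (rank_one u u) Q = Phi (lam P)], which is not [0].  Hence
    [Q = Phi (lam^-1 P) Q (rank_one u u) Q] has rank one. *)
Lemma image_rank_one_idempotent x0 y0 : ip x0 y0 = 1 ->
  exists2 u, Phi (rank_one x0 y0) u = u /\ u <> 0 &
    forall z, exists c, Phi (rank_one x0 y0) z = c *: u.
Proof.
move=> x0y0; set P := rank_one x0 y0; set Q := Phi P.
have AP : AA P by exact: (oa_rank_one algA).
have PP : P \o P = P.
  by apply/funext => z; rewrite /P /= /rank_one /= ipZl x0y0 mulr1.
have QQ z : Q (Q z) = Q z by rewrite -[LHS]/((Q \o Q) z) -PhiM// PP.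
have [z0 Qz0] : exists z, Q z <> 0.
  apply: contrapT => /forallNP Q0.
  have P0 : P = 0.
    apply: Phi_inj => //; rewrite Phi0; apply/funext => z.
    by apply: contrapT; exact: Q0.
  have : P x0 = 0 by rewrite P0.
  rewrite /P /rank_one x0y0 scale1r => x00.
  by have := x0y0; rewrite x00 ip0l => /eqP; rewrite eq_sym oner_eq0.
exists (Q z0); first by rewrite QQ.
set u := Q z0; have Qu : Q u = u by rewrite QQ.
have uu0 : ip u u != 0 by rewrite ip_eq0; apply/eqP.
have QZ c w : Q (c *: w) = c *: Q w by exact: PhiZx.
have [A hA PhiA] := Phi_surj (oa_rank_one algB u u).
pose lam := ip (A x0) y0.
have PAP : P \o A \o P = lam *: P.
  apply/funext => z.
  have [A' /formal_adjoint_linear lA] := oa_adjointable algA hA.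
  rewrite -[P \o A \o P]/(P \o (A \o P)) comp_rank_one// comp_rank_one//; last first.
    exact: oa_linear.
  by rewrite -rank_oneZl.
have AAl c : AA (c *: P) by exact: (oa_Z algA).
have QRQ z : Phi (lam *: P) z = ip (Q z) u *: u.
  have AAP : AA (P \o A) by exact: (oa_M algA).
  rewrite -PAP (PhiM AAP AP) (PhiM AP hA) PhiA.
  by rewrite -[LHS]/(Q (ip (Q z) u *: u)) QZ Qu.
have lam0 : lam != 0.
  apply/eqP => l0; have := QRQ u; rewrite l0 scale0r Phi0 Qu => /esym/eqP.
  by rewrite scaler_eq0 (negbTE uu0) => /eqP.
have QE z : Q z = ip (Q z) u *: Phi (lam^-1 *: P) u.
  have {1}-> : Q = Phi ((lam^-1 *: P) \o (lam *: P)).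
    congr Phi; apply/funext => w.
    rewrite -[RHS]/(lam^-1 *: rank_one x0 y0 (lam *: P w)).
    rewrite /rank_one ipZl -scalerA (scalerA lam^-1 lam) mulVf// scale1r.
    by rewrite -[RHS]/((P \o P) w) PP.
  rewrite (PhiM (AAl _) (AAl _)) -[LHS]/(Phi _ (Phi (lam *: P) z)) QRQ.
  by rewrite (PhiZx _ _ (AAl _)).
move=> z; exists (ip (Q z) u / ip u u).
rewrite {1}QE -scalerA; congr (_ *: _); apply: (scalerI uu0).
by rewrite scalerA divff// scale1r; have := QE u; rewrite Qu => <-.
Qed.

(** [T x] is the value at [u] of [Phi (rank_one x y0)], where [u] spans the range
    of the idempotent [Phi (rank_one x0 y0)]; the intertwining relation then comes
    from [A \o rank_one x y0 = rank_one (A x) y0].  The scalar [tau c] is defined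
    by [Phi (c *: rank_one x0 y0) u = tau c *: u]. *)
Theorem ring_isomorphism_semilinear (x0 : V) : x0 <> 0 ->
  exists T T' : op, exists tau : C -> C,
    [/\ inverse_pair T T', semilinear_map tau T & spatial_form AA Phi T T'].
Proof.
move=> /eqP x00; pose y0 := (ip x0 x0)^-1 *: x0.
have nn0 : ip x0 x0 != 0 by rewrite ip_eq0.
have x0y0 : ip x0 y0 = 1 by rewrite ipZr conj_ip_inv mulVf.
have [u [Qu /eqP u0] Qline] := image_rank_one_idempotent x0y0.
pose R x := rank_one x y0.
have AR x : AA (R x) by exact: (oa_rank_one algA).
have RM x z : R x \o R z = ip z y0 *: R x.
  apply/funext => w; rewrite -[LHS]/(ip (ip w y0 *: z) y0 *: x) ipZl.
  by rewrite mulrC -scalerA.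
pose T x := Phi (R x) u.
have TA A x : AA A -> T (A x) = Phi A (T x).
  move=> hA; rewrite /T -[RHS]/((Phi A \o Phi (R x)) u) -PhiM//.
  by rewrite comp_rank_one//; exact: oa_linear.
have Tinj : injective T.
  move=> x x' e.
  have h z : Phi (R z) = Phi (R z) \o Phi (R x0).
    by rewrite -PhiM// RM x0y0 scale1r.
  have : R x = R x'.
    apply: Phi_inj => //; rewrite h [RHS]h; apply/funext => w /=.
    have [c ->] := Qline w; rewrite !PhiZx//; congr (_ *: _); exact: e.
  move=> /(congr1 (fun f : op => f x0)).
  by rewrite /R /rank_one x0y0 !scale1r.
have Tsurj y : exists x, T x = y.
  have [A hA PhiA] := Phi_surj (oa_rank_one algB y ((ip u u)^-1 *: u)).
  exists (A x0); rewrite TA// PhiA /rank_one {1}/T Qu ipZr conj_ip_inv mulVf.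
    by rewrite scale1r.
  by rewrite ip_eq0.
have [T' TT'] := choice Tsurj.
have T'T x : T' (T x) = x by apply: Tinj; rewrite TT'.
have tauP c : exists d, Phi (c *: R x0) u = d *: u.
  have -> : c *: R x0 = R x0 \o (c *: R x0).
    apply/funext => w; rewrite -[RHS]/(ip (c *: R x0 w) y0 *: x0).
    by rewrite ipZl -scalerA -[X in _ = c *: X]/((R x0 \o R x0) w) RM x0y0 scale1r.
  rewrite PhiM//; last exact: (oa_Z algA).
  exact: Qline.
have [tau htau] := choice tauP.
exists T, T', tau; split.
- by split.
- split=> [x y|c x].
    rewrite /T -[RHS]/((Phi (R x) + Phi (R y)) u) -PhiD//.
    by rewrite -rank_oneDl.
  have -> : T (c *: x) = Phi (R x) (Phi (c *: R x0) u).
    rewrite /T -[RHS]/((Phi (R x) \o Phi (c *: R x0)) u) -PhiM//; last first.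
      exact: (oa_Z algA).
    congr (Phi _ u); apply/funext => w.
    rewrite -[RHS]/(ip (c *: R x0 w) y0 *: x) ipZl -scalerA.
    rewrite -[X in _ = c *: X]/((R x \o R x0) w) RM x0y0 scale1r.
    by rewrite /R rank_oneZl.
  by rewrite htau PhiZx.
- move=> A hA; apply/funext => y /=.
  by rewrite TA// TT'.
Qed.

End SpatialImplementation.

Section ImplementingOperators.
Variables (K : realType) (H : completeNormedModType K[i]).
Variables (dot : {dot H for Num.conj}) (D : submodClosed H).

Local Notation C := K[i].
Local Notation V := (carrier D).
Local Notation op := (V -> V).
Local Notation ip := (ip dot (D := D)).
Local Notation rank_one := (rank_one dot (D := D)).
Local Notation formal_adjoint := (formal_adjoint dot (D := D)).
Local Notation adjointable := (adjointable dot (D := D)).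

(** The image of [rank_one x0 y] maps [T z] to [tau <z, y> T x0], and it has an
    adjoint. *)
Lemma implementing_dual (AA BB : set op) (Phi : op -> op) (T T' : op)
    (tau : C -> C) (x0 : V) :
  operator_algebra dot AA -> operator_algebra dot BB -> set_fun AA BB Phi ->
  inverse_pair T T' -> semilinear_map tau T -> spatial_form AA Phi T T' ->
  x0 <> 0 ->
  forall y, exists s, forall z, tau (ip z y) = ip (T z) s.
Proof.
move=> algA algB PhiAB [TK T'K] [TD TZ] PhiE /eqP x00 y.
have T0 : T 0 = 0 by apply: (addrI (T 0)); rewrite -TD !addr0.
have nn0 : ip (T x0) (T x0) != 0.
  rewrite ip_eq0; apply: contra_neq x00 => Tx0.
  by rewrite -(TK x0) Tx0 -T0 TK.
have AR := oa_rank_one algA x0 y.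
have [B' hB] := oa_adjointable algB (PhiAB _ AR).
exists ((ip (T x0) (T x0))^-1 *: B' (T x0)) => z.
rewrite ipZr conj_ip_inv -hB PhiE//= TK /rank_one TZ ipZl.
by rewrite mulrC mulfK.
Qed.

(** The preimage [A] of [rank_one x0 v] is the map [z |-> <T z, v> T' x0]; its adjoint
    represents the functional [z |-> <T z, v>]. *)
Lemma implementing_adjointable (AA BB : set op) (Phi : op -> op) (T T' : op)
    (x0 : V) :
  operator_algebra dot AA -> operator_algebra dot BB -> set_bij AA BB Phi ->
  inverse_pair T T' -> linear T -> spatial_form AA Phi T T' ->
  x0 <> 0 -> adjointable T.
Proof.
move=> algA algB [PhiAB _ surj] [TK T'K] Tlin PhiE /eqP x00.
have T0 : T 0 = 0.
  have /eqP := Tlin 1 0 0; rewrite !scale1r addr0 -subr_eq0 opprD addNKr oppr_eq0.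
  by move/eqP.
have T'Z c x : T' (c *: x) = c *: T' x.
  rewrite -[RHS]TK -[X in T X]addr0 Tlin T0 addr0.
  by rewrite T'K.
have nn0 : ip (T' x0) (T' x0) != 0.
  rewrite ip_eq0; apply: contra_neq x00 => Tx0.
  by rewrite -(T'K x0) Tx0 T0.
suff h v : exists s, forall z, ip (T z) v = ip z s.
  by have [T'' hT] := choice h; exists T'' => x y.
have [A hA PhiA] := surj _ (oa_rank_one algB x0 v).
have [A' hA'] := oa_adjointable algA hA.
exists ((ip (T' x0) (T' x0))^-1 *: A' (T' x0)) => z.
rewrite ipZr conj_ip_inv -hA'.
have -> : A z = ip (T z) v *: T' x0.
  rewrite -T'Z -[_ *: x0]/(rank_one x0 v (T z)) -PhiA PhiE//=.
  by rewrite !TK.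
by rewrite ipZl mulrC mulfK.
Qed.
End ImplementingOperators.

(** * Reversing products with the dagger *)
Section DaggerAlgebra.
Variables (K : realType) (H : completeNormedModType K[i]).
Variables (dot : {dot H for Num.conj}).
Hypothesis hdot : forall x : H, `|x| ^+ 2 = dot x x.
Variable D : submodClosed H.
Hypothesis denseD : dense [set x : H | x \in D].

Local Notation V := (carrier D).
Local Notation op := (V -> V).
Local Notation dagger := (dagger dot (D := D)).

Definition dagger_algebra (AA : set op) : set op :=
  [set B | adjointable dot B /\ AA (dagger B)].

Let dag := daggerE hdot denseD.
Let dagP := daggerP hdot denseD.

Lemma dagger_adjointable A : adjointable dot A -> adjointable dot (dagger A).
Proof. by move=> hA; exists A; exact/formal_adjointC/dagP. Qed.

Lemma daggerK A : adjointable dot A -> dagger (dagger A) = A.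
Proof. by move=> hA; apply/dag/formal_adjointC/dagP. Qed.

Lemma daggerM A B : adjointable dot A -> adjointable dot B ->
  dagger (A \o B) = dagger B \o dagger A.
Proof. by move=> hA hB; apply/dag/formal_adjoint_comp; exact: dagP. Qed.

Lemma daggerD A B : adjointable dot A -> adjointable dot B ->
  dagger (A + B) = dagger A + dagger B.
Proof. by move=> hA hB; apply/dag/formal_adjointD; exact: dagP. Qed.

Variables AA BB : set op.
Hypothesis algA : operator_algebra dot AA.

Lemma dagger_algebra_dagger A : AA A -> dagger_algebra AA (dagger A).
Proof.
move=> hA; have aA := oa_adjointable algA hA.
by split; [exact: dagger_adjointable|rewrite daggerK].
Qed.

Lemma dagger_operator_algebra : operator_algebra dot (dagger_algebra AA).
Proof.
split=> [A []//|x y|A B [aA hA] [aB hB]|c A [aA hA]|A B [aA hA] [aB hB]].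
- split; first by exists (rank_one dot y x); exact: formal_adjoint_rank_one.
  by rewrite (dag (formal_adjoint_rank_one dot x y)); exact: (oa_rank_one algA).
- split; last by rewrite daggerD//; exact: (oa_D algA).
  by eexists; apply: formal_adjointD; exact: dagP.
- have h := formal_adjointZ c (dagP aA).
  by split; [eexists; exact: h|rewrite (dag h); exact: (oa_Z algA)].
- split; last by rewrite daggerM//; exact: (oa_M algA).
  exact: adjointable_comp.
Qed.

Lemma dagger_algebra_bij Phi : set_bij AA BB Phi ->
  set_bij (dagger_algebra AA) BB (Phi \o dagger).
Proof.
move=> [PhiAB inj surj]; split.
- by move=> A [_ hA]; exact: PhiAB.
- move=> A B /set_mem [aA hA] /set_mem [aB hB] /= /inj e.
  by rewrite -(daggerK aA) -(daggerK aB) e//; exact: mem_set.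
- move=> B /surj [A hA <-]; exists (dagger A); first exact: dagger_algebra_dagger.
  by rewrite /= daggerK//; exact: (oa_adjointable algA).
Qed.

Lemma antiisomorphism_dagger Phi : ring_antiisomorphism AA BB Phi ->
  ring_isomorphism (dagger_algebra AA) BB (Phi \o dagger).
Proof.
move=> [[bij PhiD] PhiM]; split; first split.
- exact: dagger_algebra_bij.
- by move=> A B [aA hA] [aB hB] /=; rewrite daggerD// PhiD.
- by move=> A B [aA hA] [aB hB] /=; rewrite daggerM// PhiM.
Qed.

Lemma spatial_form_dagger Phi T T' :
  spatial_form (dagger_algebra AA) (Phi \o dagger) T T' <->
  spatial_dagger_form dot AA Phi T T'.
Proof.
split=> h A.
  move=> hA; rewrite -h; last exact: dagger_algebra_dagger.
  by rewrite /= daggerK//; exact: (oa_adjointable algA).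
by move=> [aA hA] /=; rewrite (h _ hA) daggerK.
Qed.
End DaggerAlgebra.

(** * Orthogonal sequences and Cauchy-Schwarz *)
Section InnerProductGeometry.
Variables (K : realType) (H : completeNormedModType K[i]).
Variables (dot : {dot H for Num.conj}).
Hypothesis hdot : forall x : H, `|x| ^+ 2 = dot x x.
Variable D : submodClosed H.

Local Notation C := K[i].
Local Notation V := (carrier D).
Local Notation ip := (ip dot (D := D)).

Lemma ip_cauchy_schwarz (x y : V) : `|ip x y| <= `|val x| * `|val y|.
Proof.
have [->|y0] := eqVneq y 0; first by rewrite ip0r normr0 mulr_ge0.
have nn0 : ip y y != 0 by rewrite ip_eq0.
have yy0 : 0 < ip y y by rewrite lt_def nn0 dnorm_ge0.
rewrite -(@ler_pXn2r _ 2) ?nnegrE ?mulr_ge0// exprMn !hdot -/(ip x x) -/(ip y y).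
pose a := ip x y / ip y y; pose z := x - a *: y.
have zy : ip z y = 0 by rewrite ipDl ipNl ipZl divfK// subrr.
have : 0 <= ip z z by exact: dnorm_ge0.
rewrite {2}/z ipDr ipNr ipZr zy mulr0 subr0 ipDl ipNl ipZl [ip y x]ipC subr_ge0.
by rewrite mulrAC -normCK ler_pdivrMr.
Qed.

(** The orthogonal complement of a finite set has finite codimension.  Adding [z]
    to the set costs one more vector [v], orthogonal to the previous ones, unless
    [z] imposes no new condition. *)
Lemma orthogonal_decomposition (s : seq V) : exists n (e : nat -> V),
  forall x, exists c : nat -> C, forall y, y \in s ->
    ip (x - \sum_(i < n) c i *: e i) y = 0.
Proof.
elim: s => [|z s [n [e IH]]]; first by exists 0%N, (fun=> 0) => x; exists (fun=> 0).
have [[v [vs vz]]|nov] := pselect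
  (exists v, (forall y, y \in s -> ip v y = 0) /\ ip v z != 0).
  exists n.+1, (fun i => if i == n then v else e i) => x.
  have [c hc] := IH x; set r := x - _ in hc.
  exists (fun i => if i == n then ip r z / ip v z else c i) => y ys.
  rewrite big_ord_recr /= eqxx opprD addrA.
  have -> : \sum_(i < n) (if (i : nat) == n then ip r z / ip v z else c i) *:
      (if (i : nat) == n then v else e i) = \sum_(i < n) c i *: e i.
    by apply: eq_bigr => i _; rewrite (ltn_eqF (ltn_ord i)).
  rewrite -/r ipDl ipNl ipZl; move: ys; rewrite inE => /orP[/eqP ->|ys].
    by rewrite divfK// subrr.
  by rewrite (hc _ ys) (vs _ ys) mulr0 subr0.
exists n, e => x; have [c hc] := IH x; exists c => y.
rewrite inE => /orP[/eqP ->|/hc//].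
apply: contrapT => /eqP nz; apply: nov.
by exists (x - \sum_(i < n) c i *: e i).
Qed.

Lemma orthogonal_sequence : infinite_dimensional V ->
  exists y : nat -> V, (forall n, y n != 0) /\
    (forall m n, m != n -> ip (y m) (y n) = 0).
Proof.
move=> dimV.
have next (s : seq V) : exists v, v != 0 /\ forall y, y \in s -> ip v y = 0.
  apply: contrapT => /forallNP no.
  have [n [e he]] := orthogonal_decomposition s.
  apply: (dimV n); exists (fun i => e i) => x; have [c hc] := he x.
  exists (fun i => c i); apply/eqP; rewrite -subr_eq0; apply/negPn/negP => r0.
  by apply: (no (x - \sum_(i < n) c i *: e i)).
have [f hf] := choice next.
pose L n := iter n (fun s => f s :: s) [::].
exists (fun n => f (L n)); split=> [n|m n]; first by have [] := hf (L n).
have memL i j : (i < j)%N -> f (L i) \in L j.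
  elim: j => // j IHj; rewrite ltnS leq_eqVlt => /orP[/eqP ->|/IHj ij].
    by rewrite /L iterS inE eqxx.
  by rewrite /L iterS inE ij orbT.
rewrite neq_ltn => /orP[mn|nm]; last by have [_] := hf (L m); apply; exact: memL.
have [_ /(_ _ (memL _ _ mn)) h] := hf (L n).
by rewrite ipC h rmorph0.
Qed.

End InnerProductGeometry.

Section ComplexBounds.
Variable K : realType.
Local Notation C := K[i].

Lemma complex_natr_bound (x : C) : exists n, `|x| <= n%:R.
Proof.
exists (Num.bound (Num.sqrt ((complex.Re x) ^+ 2 + (complex.Im x) ^+ 2))).
rewrite normc_def -(rmorph_nat (real_complex K)) lecR.
by apply/ltW/archi_boundP/sqrtr_ge0.
Qed.

Lemma complex_geometric_small (e : C) : 0 < e -> exists n, (2%:R^-1 : C) ^+ n < e.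
Proof.
move=> e0; have [n hn] := complex_natr_bound e^-1.
exists n; rewrite exprVn -[ltRHS]invrK ltf_pV2 ?posrE ?invr_gt0 ?exprn_gt0//.
apply: (le_lt_trans (real_ler_norm _)); first by rewrite gtr0_real ?invr_gt0.
by apply: (le_lt_trans hn); rewrite -natrX ltr_nat ltn_expl.
Qed.

End ComplexBounds.

(** * Convergence of series in the graph topology *)
Lemma sup_entourage (T : choiceType) (I : Type) (Tc : I -> Uniform T)
    (E : set (sup_topology Tc * sup_topology Tc)) : entourage E ->
  exists s : seq (I * set (T * T)),
    (forall p, List.In p s -> @entourage (Uniform.Pack (Tc p.1)) p.2) /\
    forall xy, (forall p, List.In p s -> p.2 xy) -> E xy.
Proof.
move=> [B [F _ <-] sFE].
suff [s [ent h]] : exists s : seq (I * set (T * T)),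
    (forall p, List.In p s -> @entourage (Uniform.Pack (Tc p.1)) p.2) /\
    forall xy, (forall p, List.In p s -> p.2 xy) ->
      forall p, p \in enum_fset F -> (projT1 p).2 xy.
  by exists s; split=> // xy /h hxy; apply: sFE => p pF; exact: hxy.
elim: (enum_fset F) => [|[[i U] pU] s [t [ent h]]]; first by exists [::]; split.
have /= entU := asboolW pU.
exists ((i, U) :: t); split=> [p [<-|/ent]//|xy ht p].
rewrite inE => /orP[/eqP -> /=|]; first exact: (ht (i, U) (or_introl erefl)).
by apply: h => q tq; apply: ht; right.
Qed.

Lemma sup_entourage_component (T : choiceType) (I : Type)
    (Tc : I -> Uniform T) (i : I) (E : set (T * T)) :
  @entourage (Uniform.Pack (Tc i)) E ->
  entourage (E : set (sup_topology Tc * sup_topology Tc)).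
Proof.
move=> entE; pose p : {p : {classic I} * set (T * T) |
    `[< @entourage (Uniform.Pack (Tc p.1)) p.2 >]} :=
  exist _ (i, E) (asboolT entE).
exists E => //; exists [fset p]%fset.
  by move=> q _; rewrite inE.
rewrite eqEsubset; split=> xy; first by move=> /(_ _ (fset11 _)).
by move=> Exy q /=; rewrite inE => /eqP ->.
Qed.

Section GraphTopology.
Variables (K : realType) (H : completeNormedModType K[i]).
Variables (dot : {dot H for Num.conj}).
Hypothesis hdot : forall x : H, `|x| ^+ 2 = dot x x.
Variable D : submodClosed H.
Hypothesis denseD : dense [set x : H | x \in D].

Local Notation C := K[i].
Local Notation V := (carrier D).
Local Notation ip := (ip dot (D := D)).
Local Notation Lop := {A : V -> V | Lplus dot A}.
Local Notation graph_space := (graph_space dot D).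

Definition seminorm_ball (l : seq Lop) (e : C) : set V :=
  [set x | forall A, List.In A l -> `|val (sval A x)| < e].

Lemma Lop_sub (A : Lop) (x y : V) : sval A (x - y) = sval A x - sval A y.
Proof.
case: A => A [lA _] /=.
by rewrite addrC -scaleN1r lA scaleN1r addrC.
Qed.

Lemma val_Lop_sub (A : Lop) (x y : V) :
  val (sval A (x - y)) = val (sval A x) - val (sval A y).
Proof. by rewrite Lop_sub GRing.valB. Qed.

Lemma Lop_scale (A : Lop) c (x : V) : sval A (c *: x) = c *: sval A x.
Proof.
have A0 : sval A 0 = 0 by rewrite -{1}(subrr (0 : V)) Lop_sub subrr.
case: A A0 => A [lA _] /= A0.
by rewrite -[c *: x]addr0 lA A0 addr0.
Qed.

Lemma norm_Lop_opp (A : Lop) (x : V) : `|val (sval A (- x))| = `|val (sval A x)|.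
Proof. by rewrite -scaleN1r Lop_scale scaleN1r GRing.valN normrN. Qed.

Lemma graph_entourage (E : set (graph_space * graph_space)) : entourage E ->
  exists l e, 0 < e /\ forall x y : V, seminorm_ball l e (x - y) -> E (x, y).
Proof.
move=> /sup_entourage [s [ent sE]].
suff [l [e [e0 h]]] : exists l e, 0 < e /\ forall x y : V,
    seminorm_ball l e (x - y) -> forall p, List.In p s -> p.2 (x, y).
  by exists l, e; split=> // x y /h xy; apply: sE => p ps; exact: xy.
elim: s ent {sE} => [|[A E0] s IHs] ent; first by exists [::], 1; split.
have [l [e [e0 IH]]] := IHs (fun p ps => ent p (or_intror ps)).
have entE := ent _ (or_introl erefl).
have [U entU sUE] : exists2 U : set (H * H), entourage U &
    forall x y : V, U (val (sval A x), val (sval A y)) -> E0 (x, y).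
  by case: entE => U entU sUE; exists U => // x y h; exact: (sUE (x, y)) h.
move: entU; rewrite -entourage_ballE => -[d /= d0 sdU].
pose m := if d <= e then d else e.
have [m0 md me] : [/\ 0 < m, m <= d & m <= e].
  by rewrite /m; have [de|/ltW] := real_leP (gtr0_real d0) (gtr0_real e0).
exists (A :: l), m; split=> // x y h p [<-|]; last first.
  apply: IH => B lB; apply: lt_le_trans me; apply: h; right; exact: lB.
have xy : `|val (sval A x) - val (sval A y)| < d.
  by rewrite -GRing.valB -Lop_sub; apply: lt_le_trans md; apply: h; left.
by apply/sUE/sdU; rewrite /= -ball_normE.
Qed.

Lemma graph_entourage_seminorm (A : Lop) (e : C) : 0 < e ->
  @entourage graph_space [set xy : V * V | `|val (sval A (xy.1 - xy.2))| < e].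
Proof.
move=> e0; apply: sup_entourage_component.
exists [set xy : H * H | ball xy.1 e xy.2].
  by rewrite -entourage_ballE; exists e.
move=> -[x y] xy; have {xy} : ball (val (sval A x)) e (val (sval A y)) := xy.
rewrite -ball_normE => xy.
suff : `|val (sval A (x - y))| < e by [].
by rewrite val_Lop_sub; exact: xy.
Qed.

Lemma nbhs_seminorm_ball (A : Lop) :
  nbhs (0 : graph_space) [set x : V | `|val (sval A x)| < 1].
Proof.
have := nbhs_entourage (0 : graph_space) (graph_entourage_seminorm A ltr01).
apply: filterS => x /xsectionP h.
have {h} : `|val (sval A (0 - x))| < 1 by exact: h.
by rewrite sub0r norm_Lop_opp.
Qed.

(** Each ball of radius [1 / (n + 1)] around [0] contains a basic neighbourhood,
    and every neighbourhood of [0] contains such a ball. *)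
Lemma countable_seminorms : metrizable K graph_space ->
  exists (w : nat -> seq Lop) (e : nat -> C), (forall n, 0 < e n) /\
    forall A : Lop, exists n, forall x, seminorm_ball (w n) (e n) x ->
      `|val (sval A x)| < 1.
Proof.
move=> [d [d0 _ _ dn]].
have basis n : exists le : seq Lop * C, 0 < le.2 /\
    forall x, seminorm_ball le.1 le.2 x -> d 0 x < n.+1%:R^-1.
  have : nbhs (0 : graph_space) [set y | d 0 y < n.+1%:R^-1].
    by apply/dn; exists n.+1%:R^-1 => //; rewrite invr_gt0.
  rewrite -nbhs_entourageE => -[E entE sE].
  have [l [e [e0 h]]] := graph_entourage entE.
  exists (l, e); split=> // x hx; apply: sE; rewrite /xsection /= inE.
  by apply: h; rewrite sub0r => A lA; rewrite norm_Lop_opp; exact: hx.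
have [f hf] := choice basis.
exists (fun n => (f n).1), (fun n => (f n).2); split=> [n|A].
  by have [] := hf n.
have /dn [r r0 hr] := nbhs_seminorm_ball A.
exists (Num.bound r^-1) => x /(hf _).2 dx; apply: hr; apply: (lt_trans dx).
rewrite -[ltRHS]invrK ltf_pV2 ?posrE ?invr_gt0//.
apply: (lt_trans (archi_boundP _)); first by rewrite invr_ge0 ltW.
by rewrite ltr_nat.
Qed.

Lemma le_sum_In (T : Type) (f : T -> C) (l : seq T) (B : T) :
  (forall b, 0 <= f b) -> List.In B l -> f B <= \sum_(b <- l) f b.
Proof.
move=> f0; elim: l => // b l IH; rewrite big_cons => -[->|/IH fB].
  by rewrite lerDl sumr_ge0.
by apply: le_trans fB _; rewrite lerDr.
Qed.

Lemma id_Lplus : Lplus dot (idfun : V -> V).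
Proof. by apply/(LplusE hdot denseD); exact: adjointable_id. Qed.

(** Choose [delta n] so small that [c n *: y n] is at most [2 ^ -n] for the
    first [n] groups of a countable defining family of seminorms: the partial
    sums are then Cauchy for each of them, hence for the graph uniformity. *)
Lemma frechet_series (y : nat -> V) : F_space dot D ->
  exists delta : nat -> C, (forall n, 0 < delta n) /\
    forall c : nat -> C, (forall n, `|c n| < delta n) ->
      exists psi : V, forall e : C, 0 < e -> exists N, forall n, (N <= n)%N ->
        `|val psi - val (\sum_(i < n) c i *: y i)| < e.
Proof.
move=> [/countable_seminorms [w [r [r0 hw]]] complete].
pose h : C := 2%:R^-1.
have h0 n : 0 < h ^+ n by rewrite exprn_gt0// invr_gt0.
pose M n := 1 + \sum_(j < n.+1) \sum_(B <- w j) `|val (sval B (y n))|.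
have M0 n : 0 < M n.
  by rewrite ltr_pwDl// sumr_ge0// => j _; exact: sumr_ge0.
have leM n j B : (j <= n)%N -> List.In B (w j) -> `|val (sval B (y n))| <= M n.
  move=> jn wB; apply: (@le_trans _ _ (\sum_(B <- w j) `|val (sval B (y n))|)).
    exact: (le_sum_In (f := fun B : Lop => `|val (sval B (y n))|)).
  have jn' : (j < n.+1)%N by [].
  rewrite /M (bigD1 (Ordinal jn')) //= addrCA lerDl addr_ge0// sumr_ge0// => i _.
  exact: sumr_ge0.
exists (fun n => h ^+ n / M n); split=> [n|c hc]; first by rewrite divr_gt0.
pose S n : V := \sum_(i < n) c i *: y i.
have key1 n j B : (j <= n)%N -> List.In B (w j) ->
    `|val (sval B (c n *: y n))| <= h ^+ n.
  move=> jn wB; rewrite Lop_scale GRing.valZ normrZ -[leRHS](divfK (lt0r_neq0 (M0 n))).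
  by apply: ler_pM => //; [exact: ltW|exact: leM wB].
have key2 n m j B : (j <= m)%N -> List.In B (w j) ->
    `|val (sval B (S (m + n)%N - S m))| <= 2%:R * h ^+ m - 2%:R * h ^+ (m + n)%N.
  move=> jm wB; elim: n => [|n IH].
    by rewrite addn0 val_Lop_sub !subrr normr0.
  have -> : S (m + n.+1)%N - S m = (S (m + n)%N - S m) - - (c (m + n)%N *: y (m + n)%N).
    by rewrite /S addnS big_ord_recr /= opprK addrAC.
  rewrite val_Lop_sub; apply: (le_trans (ler_normB _ _)); rewrite norm_Lop_opp.
  have := lerD IH (key1 (m + n)%N j B (leq_trans jm (leq_addr _ _)) wB).
  move=> /le_trans; apply; rewrite addnS exprS.
  have -> : (2%:R : C) * (h * h ^+ (m + n)%N) = h ^+ (m + n)%N.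
    by rewrite mulrA divff ?mul1r// pnatr_eq0.
  by rewrite -addrA lerD2l mulr_natl mulr2n opprD addrNK.
have key3 (A : Lop) (e : C) : 0 < e -> exists N, forall m n, (N <= m)%N ->
    (N <= n)%N -> `|val (sval A (S n - S m))| < e.
  move=> e0; have [j hj] := hw A.
  have q0 : 0 < e * r j / 2%:R by rewrite divr_gt0// mulr_gt0.
  have [N0 hN0] := complex_geometric_small q0.
  suff H1 m n : (maxn j N0 <= m)%N -> `|val (sval A (S (m + n)%N - S m))| < e.
    exists (maxn j N0) => m n jm jn; have [mn|/ltnW nm] := leqP m n.
      by rewrite -(subnKC mn); exact: H1.
    by rewrite -opprB norm_Lop_opp -(subnKC nm); exact: H1.
  rewrite geq_max => /andP[jm N0m].
  have : `|val (sval A (e^-1 *: (S (m + n)%N - S m)))| < 1.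
    apply: hj => B wB; rewrite Lop_scale GRing.valZ normrZ gtr0_norm ?invr_gt0//.
    have hm : h ^+ m < e * r j / 2%:R.
      apply: le_lt_trans hN0; apply: ler_wiXn2l => //; first by rewrite invr_ge0.
      by rewrite invf_le1// ler1n.
    rewrite ltr_pdivlMr// in hm; rewrite ltr_pdivrMl//.
    apply: (le_lt_trans (key2 n m j B jm wB)); apply: le_lt_trans hm.
    by rewrite [leRHS]mulrC gerBl mulr_ge0// ltW.
  rewrite Lop_scale GRing.valZ normrZ gtr0_norm ?invr_gt0//.
  by rewrite ltr_pdivrMl// mulr1.
have key4 (l : seq Lop) (e : C) : 0 < e -> exists N, forall m n, (N <= m)%N ->
    (N <= n)%N -> seminorm_ball l e (S n - S m).
  move=> e0; elim: l => [|A l [N IH]]; first by exists 0%N => m n _ _ B [].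
  have [N' hN'] := key3 A e e0; exists (maxn N N') => m n.
  rewrite !geq_max => /andP[Nm N'm] /andP[Nn N'n] B [<-|lB]; first exact: hN'.
  exact: (IH m n Nm Nn).
have [|psi hpsi] := complete ((S : nat -> graph_space) @ \oo) _.
  move=> E /graph_entourage [l [e [e0 hE]]]; have [N hN] := key4 l e e0.
  exists ([set S n | n in [set n | (N <= n)%N]], [set S n | n in [set n | (N <= n)%N]]).
    by split=> /=; exists N => // n /= Nn; exists n.
  by move=> [a b] /= [[m Nm <-] [n Nn <-]]; apply: hE; exact: hN.
exists psi => e e0.
have := nbhs_entourage (psi : graph_space)
  (graph_entourage_seminorm (exist _ _ id_Lplus) e0).
move=> /hpsi [N _ hN]; exists N => n Nn.
have /xsectionP := hN n Nn.
by rewrite -GRing.valB; exact.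
Qed.

End GraphTopology.

(** * Ring endomorphisms of the complex numbers bounded near zero *)
Section ContinuousAutomorphisms.
Local Open Scope complex_scope.
Variable K : realType.
Local Notation C := K[i].
Variable tau : C -> C.
Hypothesis tauD : forall a b, tau (a + b) = tau a + tau b.
Hypothesis tauM : forall a b, tau (a * b) = tau a * tau b.
Hypothesis tau1 : tau 1 = 1.

(** The additive map [g r = tau r - r] vanishes on integers and is bounded on
    the unit interval, hence [n * g r = g (n * r)] is bounded independently of [n]. *)
Lemma bounded_field_morphism (eps M : C) : 0 < eps ->
  (forall c, `|c| < eps -> `|tau c| <= M) ->
  tau =1 id \/ tau =1 Num.conj.
Proof.
move=> eps0 tauM'.
have tau0 : tau 0 = 0 by apply: (addrI (tau 0)); rewrite -tauD !addr0.
have tauN a : tau (- a) = - tau a.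
  by apply: (addrI (tau a)); rewrite -tauD !subrr.
have tau_nat n : tau n%:R = n%:R.
  by elim: n => // n IHn; rewrite -natr1 tauD IHn tau1.
have tau_int m : tau m%:~R = m%:~R.
  by case: m => n; rewrite ?NegzE ?mulrNz ?tauN -pmulrn tau_nat.
pose g (r : K) := tau r%:C - r%:C.
have gD r s : g (r + s) = g r + g s.
  by rewrite /g rmorphD tauD opprD addrACA.
have g_int m : g m%:~R = 0 by rewrite /g rmorph_int tau_int subrr.
have gMn n r : g (n%:R * r) = n%:R * g r.
  by rewrite /g rmorphM rmorph_nat tauM tau_nat mulrBr.
have [B hB] : exists B : C, forall x : K, 0 <= x < 1 -> `|g x| <= B.
  have [n hn] := complex_natr_bound eps^-1.
  exists (n.+1%:R * (M + eps)) => x /andP[x0 x1].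
  have -> : x = n.+1%:R * (x / n.+1%:R) by rewrite mulrC divfK// pnatr_eq0.
  rewrite gMn normrM normr_nat ler_wpM2l//.
  have small : `|(x / n.+1%:R)%:C| < eps.
    rewrite normc_def /= expr0n addr0 sqrtr_sqr ger0_norm ?divr_ge0//.
    rewrite rmorphM fmorphV rmorph_nat ltr_pdivrMr//.
    rewrite mulrC -ltr_pdivrMr// [ltLHS]mulrC.
    apply: (@le_lt_trans _ _ eps^-1).
      by rewrite ler_piMr ?invr_ge0 ?(ltW eps0)// lecR ltW.
    apply: (le_lt_trans (real_ler_norm _)); first by rewrite gtr0_real ?invr_gt0.
    by apply: (le_lt_trans hn); rewrite ltr_nat.
  by apply: (le_trans (ler_normB _ _)); rewrite lerD ?tauM'// ltW.
have g0 r : g r = 0.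
  apply/eqP; rewrite -normr_eq0; apply/negPn/negP => gr0.
  have gr_gt0 : 0 < `|g r| by rewrite lt_def gr0 normr_ge0.
  have [n hn] := complex_natr_bound (B / `|g r|).
  have : n.+1%:R * `|g r| <= B.
    rewrite -normr_nat -normrM -gMn.
    have /andP[fl fu] := floor_itv (n.+1%:R * r).
    rewrite -[n.+1%:R * r](subrK (Num.floor (n.+1%:R * r))%:~R) gD g_int addr0.
    by apply: hB; rewrite subr_ge0 fl ltrBlDl -[1]/(1%:~R) -intrD.
  rewrite -ler_pdivlMr// => nB; have : n.+1%:R <= n%:R :> C.
    apply: (le_trans nB); apply: le_trans hn; apply: real_ler_norm.
    by apply: ger0_real; apply: le_trans nB.
  by rewrite ler_nat ltnn.
have tau_real r : tau r%:C = r%:C.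
  by apply/eqP; rewrite -subr_eq0; apply/eqP; exact: g0.
have : (tau 'i%C - 'i%C) * (tau 'i%C + 'i%C) == 0.
  by rewrite -subr_sqr expr2 -tauM -expr2 sqr_i tauN tau1 subrr.
rewrite mulf_eq0 => /orP[|] /eqP ti; [left|right] => c;
  rewrite [c]complexE tauD tauM !tau_real.
  by move/eqP: ti; rewrite subr_eq0 => /eqP ->.
move/eqP: ti; rewrite addr_eq0 => /eqP ->.
by rewrite -complexE mulNr; case: c => a b; simpc.
Qed.
End ContinuousAutomorphisms.

(** * Boundedness of the scalar automorphism *)
Section FrechetDomain.
Variables (K : realType) (H : completeNormedModType K[i]).
Variables (dot : {dot H for Num.conj}).
Hypothesis hdot : forall x : H, `|x| ^+ 2 = dot x x.
Variable D : submodClosed H.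
Hypothesis denseD : dense [set x : H | x \in D].
Hypothesis FD : F_space dot D.
Hypothesis dimD : infinite_dimensional (carrier D).

Local Notation C := K[i].
Local Notation V := (carrier D).
Local Notation ip := (ip dot (D := D)).

Lemma ip_suml n (F : 'I_n -> V) z : ip (\sum_i F i) z = \sum_i ip (F i) z.
Proof.
by apply: (big_morph (fun x => ip x z)) => [x y|]; [exact: ipDl|exact: ip0l].
Qed.

Lemma dual_map_bounded (tau : C -> C) (T : V -> V) :
  (forall y, exists s, forall z, tau (ip z y) = ip (T z) s) ->
  exists eps M : C, 0 < eps /\ forall c, `|c| < eps -> `|tau c| <= M.
Proof.
move=> dual; apply: contrapT => unb.
have [y [y0 yorth]] := orthogonal_sequence dot dimD.
(* w is biorthogonal to y, so that <sum c_i y_i, w n> is c n. *)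
pose w n := (ip (y n) (y n))^-1 *: y n.
have [s hs] := choice (fun n => dual (w n)).
have [delta [delta0 conv]] := frechet_series hdot denseD y FD.
have big n : exists c, `|c| < delta n /\ ~ `|tau c| <= n%:R * `|val (s n)|.
  apply: contrapT => /forallNP no; apply: unb.
  exists (delta n), (n%:R * `|val (s n)|); split=> // c cd.
  by apply: contrapT => h; apply: (no c).
have [c hc] := choice big.
have [psi hpsi] := conv c (fun n => (hc n).1).
have coef n : ip psi (w n) = c n.
  apply/eqP; rewrite -subr_eq0 -normr_eq0; apply/negPn/negP => d0.
  set d := `|_| in d0; have d_gt0 : 0 < d by rewrite lt_def d0 normr_ge0.
  have wn1 : 0 < `|val (w n)| + 1 by rewrite ltr_wpDl.
  have [N hN] := hpsi (d / (`|val (w n)| + 1)) (divr_gt0 d_gt0 wn1).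
  pose m := maxn N n.+1; have nm : (n < m)%N by rewrite leq_maxr.
  have Sw : ip (\sum_(i < m) c i *: y i) (w n) = c n.
    rewrite ip_suml (bigD1 (Ordinal nm)) //= big1 => [|i].
      by rewrite addr0 ipZl /w ipZr conj_ip_inv mulVf ?mulr1// ip_eq0.
    by rewrite -val_eqE /= => ne; rewrite ipZl /w ipZr (yorth _ _ ne) !mulr0.
  have : d <= d / (`|val (w n)| + 1) * `|val (w n)|.
    rewrite {1}/d -Sw -ipNl -ipDl.
    apply: (le_trans (ip_cauchy_schwarz hdot _ _)).
    by rewrite ler_wpM2r// GRing.valB ltW// hN// leq_maxl.
  rewrite -mulrA ler_pMr// mulrC ler_pdivlMr// mul1r.
  by rewrite gerDl ler10.
have [n hn] := complex_natr_bound `|val (T psi)|.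
apply: (hc n).2; rewrite -coef hs; apply: (le_trans (ip_cauchy_schwarz hdot _ _)).
by rewrite ler_wpM2r//; move: hn; rewrite normr_id.
Qed.

End FrechetDomain.

(** * Spatial forms *)
Section SpatialForm.
Variables (K : realType) (H : completeNormedModType K[i]).
Variables (dot : {dot H for Num.conj}).
Hypothesis hdot : forall x : H, `|x| ^+ 2 = dot x x.
Variable D : submodClosed H.
Hypothesis denseD : dense [set x : H | x \in D].
Local Notation V := (carrier D).

Lemma semilinear_field_morphism (tau : K[i] -> K[i]) (T : V -> V) (x : V) :
  semilinear_map tau T -> T x <> 0 ->
  [/\ forall a b, tau (a + b) = tau a + tau b,
      forall a b, tau (a * b) = tau a * tau b & tau 1 = 1].
Proof.
move=> [TD TZ] /eqP Tx0.
have inj a b : a *: T x = b *: T x -> a = b.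
  move=> /eqP; rewrite -subr_eq0 -scalerBl scaler_eq0 (negbTE Tx0) orbF.
  by rewrite subr_eq0 => /eqP.
split=> [a b|a b|]; apply: inj; rewrite -TZ.
- by rewrite scalerDl TD !TZ -scalerDl.
- by rewrite -scalerA !TZ scalerA.
- by rewrite !scale1r.
Qed.

Lemma ring_isomorphism_spatial (AA BB : set (V -> V)) (Phi : (V -> V) -> V -> V) :
  F_space dot D -> infinite_dimensional V ->
  operator_algebra dot AA -> operator_algebra dot BB ->
  ring_isomorphism AA BB Phi ->
  exists T T' : V -> V, [/\ inverse_pair T T', linear T \/ conjugate_linear T &
    spatial_form AA Phi T T'].
Proof.
move=> FD dimD algA algB iso.
have [x x0] : exists x : V, x <> 0 by apply: nonzero_ex (dimD 1%N).
have [T [T' [tau [TT' Tsemi PhiE]]]] := ring_isomorphism_semilinear algA algB iso x0.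
have [[[PhiAB _ _] _] _] := iso.
have dual := implementing_dual algA algB PhiAB TT' Tsemi PhiE x0.
have [eps [M [eps0 tauM]]] := dual_map_bounded hdot denseD FD dimD dual.
have [TK _] := TT'; have [TD TZ] := Tsemi.
have Tx0 : T x <> 0.
  have T0 : T 0 = 0 by apply: (addrI (T 0)); rewrite -TD !addr0.
  by move=> Tx0; apply: x0; rewrite -(TK x) Tx0 -T0 TK.
have [tD tM t1] := semilinear_field_morphism Tsemi Tx0.
exists T, T'; split=> //.
by have [tau_id|tau_conj] := bounded_field_morphism tD tM t1 eps0 tauM;
  [left|right] => c u v; rewrite TD TZ ?tau_id ?tau_conj.
Qed.
End SpatialForm.

Theorem theorem2p1 (R : realType) (H : completeNormedModType R[i])
  (dot : {dot H for Num.conj}) (hdot : forall x : H, `|x| ^+ 2 = dot x x)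
  (D : submodClosed H) (denseD : dense [set x : H | x \in D])
  (FD : F_space dot D) (dimD : ~ spanned_by (carrier D) 1)
  (AA BB : set (carrier D -> carrier D))
  (stdA : standard_operator_algebra dot AA)
  (stdB : standard_operator_algebra dot BB)
  (Phi : (carrier D -> carrier D) -> (carrier D -> carrier D))
  (jordanPhi : k_Jordan_map AA BB Phi) :
  [/\ ring_isomorphism AA BB Phi \/ ring_antiisomorphism AA BB Phi,
      infinite_dimensional (carrier D) ->
        (exists T T' : carrier D -> carrier D,
           [/\ inverse_pair T T', linear T \/ conjugate_linear T &
               spatial_form AA Phi T T']) \/
        (exists T T' : carrier D -> carrier D,
           [/\ inverse_pair T T', linear T \/ conjugate_linear T &
               spatial_dagger_form dot AA Phi T T']) &
      forall T T' : carrier D -> carrier D, inverse_pair T T' ->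
        spatial_form AA Phi T T' \/ spatial_dagger_form dot AA Phi T T' ->
        linear T -> Lplus dot T].
Proof.
have algA := standard_operator_algebraW hdot denseD stdA.
have algB := standard_operator_algebraW hdot denseD stdB.
have algAd := dagger_operator_algebra hdot denseD algA.
have isos := jordan_map_iso_or_antiiso dimD algA algB jordanPhi.
split=> // [dim_inf|T T' TT' forms Tlin].
  have [iso|anti] := isos; [left|right].
    exact: (ring_isomorphism_spatial hdot denseD FD dim_inf algA algB iso).
  have iso := antiisomorphism_dagger hdot denseD algA anti.
  have [T [T' [TT' Tlin /(spatial_form_dagger hdot denseD algA) PhiE]]] :=
    ring_isomorphism_spatial hdot denseD FD dim_inf algAd algB iso.
  by exists T, T'.
have [x x0] := nonzero_ex dimD.
have [bij _] := jordanPhi.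
apply/(LplusE hdot denseD).
have [PhiE|/(spatial_form_dagger hdot denseD algA) PhiE] := forms.
  exact: (implementing_adjointable algA algB bij TT' Tlin PhiE x0).
have bijd := dagger_algebra_bij hdot denseD algA bij.
exact: (implementing_adjointable algAd algB bijd TT' Tlin PhiE x0).
Qed.
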